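(* Let $F$ be a finite group containing at least two elements, and let $\mu$ be a measure on $G=\mathbb{Z}^2\wr F$ which defines a standard aperiodic switch-walk-switch random walk. Assume that the support of the projection $\nu$ of $\mu$ to $\mathbb{Z}^2$ consists of $5$ elements: the two standard generators of $\mathbb{Z}^2$, their inverses and the neutral element. Let $L(n)$ be the drift function of $(G,\mu)$. Then the radius of individual almost invariance of $(G,\mu)$ is asymptotically strictly larger than $n/L(n)$; that is, there is a function $\rho(n)$ with $\rho(n)\big/\bigl(n/L(n)\bigr)\to\infty$ as $n\to\infty$ such that $\bar r(n)\succeq\rho(n)$.
   Context: The wreath product $A\wr B$ is the semidirect product of $A$ and $\sum_A B$ (finitely supported functions $A\to B$), where $A$ acts by shifts; $A$ and $B$ are embedded in the standard way ($B$ as functions supported at $e_A$). A standard switch-walk-switch random walk on $\mathbb{Z}^2\wr F$ is given by $\mu=\mu_F*\mu_{\mathbb{Z}^2}*\mu_F$ with $\mu_F$ the uniform distribution on $F$ and $\mu_{\mathbb{Z}^2}$ a symmetric measure on $\mathbb{Z}^2$ (here with the $5$-element support above). Aperiodic means that the greatest common divisor of the $K\ge 1$ with $\mu^{*K}(e)>0$ is $1$. Let $S$ be a finite generating set of $G$ with word length $l_S$. The drift function is $L(n)=\sum_{g\in G}l_S(g)\mu^{*n}(g)$. For $r:\mathbb{N}\to[0,\infty)$, $(G,\mu)$ has individually almost invariant distributions on the scale $r(n)$ if for every $\epsilon>0$ and every sequence $g_n\in G$ with $l_S(g_n)\le r(n)$ there exist subsets $V_{\epsilon,n}\subset G$ such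 that for all sufficiently large $n$: $\mu^{*n}(V_{\epsilon,n})\ge 1-\epsilon$, and for all $h\in V_{\epsilon,n}$, $\mu^{*n}(h)>0$ and $|\mu^{*n}(hg_n)/\mu^{*n}(h)-1|\le\epsilon$. The relation $\bar r(n)\succeq r(n)$ means: $(G,\mu)$ has individually almost invariant distributions on the scale $r''(n)$ for any $r''(n)$ with $r''(n)/r(n)\to 0$. *)

(* Defs.v *)
From HB Require Import structures.
From mathcomp Require Import all_boot all_order all_algebra all_fingroup.
From mathcomp Require Import finmap.
From mathcomp Require Import all_classical all_reals all_analysis.

Set Implicit Arguments.
Unset Strict Implicit.
Unset Printing Implicit Defensive.

Import Order.TTheory GRing.Theory Num.Theory.
Import numFieldNormedType.Exports.

Local Open Scope classical_set_scope.
Local Open Scope ring_scope.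

(* The base group [A] is written additively; the pair [(a, f)] stands for
   [f * a] with [f] in the direct sum of copies of [B] and [a] in [A], so that
   [(a, f) (b, g) = (a + b, f . (a.g))] where [(a.g) x = g (x - a)]. *)
Section Wreath.
Variables (A : zmodType) (B : groupType).

Definition wreath : Type := (A * {fsfun A -> B with 1%g})%type.

HB.instance Definition _ := Choice.copy wreath (A * {fsfun A -> B with 1%g})%type.

Implicit Types u v w : wreath.

Definition wreath_one : wreath := (0, [fsfun of _ => 1%g]).

Definition wreath_mul u v : wreath :=
  (u.1 + v.1,
   [fsfun x in (finsupp u.2 `|` [fset (u.1 + y)%R | y in finsupp v.2])%fset =>
      (u.2 x * v.2 (x - u.1)%R)%g | 1%g]).

Definition wreath_inv u : wreath :=
  (- u.1,
   [fsfun x in [fset (y - u.1)%R | y in finsupp u.2]%fset =>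
      ((u.2 (u.1 + x)%R)^-1)%g | 1%g]).

Lemma wreath_mulE u v x :
  (wreath_mul u v).2 x = (u.2 x * v.2 (x - u.1)%R)%g.
Proof.
rewrite fsfunE; case: ifPn => //; rewrite !inE negb_or => /andP[xu xv].
rewrite (fsfun_dflt xu) mul1g fsfun_dflt //; apply: contra xv => xv.
by apply/imfsetP; exists (x - u.1) => //; rewrite addrC subrK.
Qed.

Lemma wreath_invE u x : (wreath_inv u).2 x = ((u.2 (u.1 + x)%R)^-1)%g.
Proof.
rewrite fsfunE; case: ifPn => // xu.
rewrite fsfun_dflt ?invg1 //; apply: contra xu => xu.
by apply/imfsetP; exists (u.1 + x) => //; rewrite addrC addKr.
Qed.

Lemma wreath_oneE x : wreath_one.2 x = 1%g.
Proof. by rewrite fsfunE. Qed.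

Lemma wreathP u v : u.1 = v.1 -> u.2 =1 v.2 -> u = v.
Proof. by case: u v => [a f] [b g] /= -> /fsfunP ->. Qed.

Lemma wreath_mulA : associative wreath_mul.
Proof.
move=> u v w; apply: wreathP => [|x]; first exact: addrA.
by rewrite !wreath_mulE mulgA opprD addrA.
Qed.

Lemma wreath_mul1 : left_id wreath_one wreath_mul.
Proof.
move=> u; apply: wreathP => [|x]; first exact: add0r.
by rewrite wreath_mulE wreath_oneE mul1g subr0.
Qed.

Lemma wreath_mulr1 : right_id wreath_one wreath_mul.
Proof.
move=> u; apply: wreathP => [|x]; first exact: addr0.
by rewrite wreath_mulE wreath_oneE mulg1.
Qed.

Lemma wreath_mulV : left_inverse wreath_one wreath_inv wreath_mul.
Proof.
move=> u; apply: wreathP => [|x]; first exact: addNr.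
by rewrite wreath_mulE wreath_invE wreath_oneE opprK addrC mulVg.
Qed.

Lemma wreath_mulrV : right_inverse wreath_one wreath_inv wreath_mul.
Proof.
move=> u; apply: wreathP => [|x]; first exact: subrr.
by rewrite wreath_mulE wreath_invE wreath_oneE addrC subrK mulgV.
Qed.

HB.instance Definition _ := isGroup.Build wreath
  wreath_mulA wreath_mul1 wreath_mulr1 wreath_mulV wreath_mulrV.

Definition base_proj u : A := u.1.

Definition base_emb (a : A) : wreath := (a, [fsfun of _ => 1%g]).

Definition lamp_emb (b : B) : wreath :=
  (0, [fsfun x in [fset 0 : A]%fset => b | 1%g]).

End Wreath.

(* Measures on a discrete set are given by their mass functions. *)
Section MassFunctions.
Variable R : realType.

Definition mass (T : choiceType) (p : T -> R) (V : set T) : R :=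
  fine (\esum_(x in V) (p x)%:E).

Definition is_pmf (T : choiceType) (p : T -> R) : Prop :=
  (forall x, 0 <= p x) /\ (\esum_(x in [set: T]) (p x)%:E = 1)%E.

Definition pmf_image (T U : choiceType) (f : T -> U) (p : T -> R) : U -> R :=
  fun y => mass p (f @^-1` [set y]).

Definition uniform_pmf (T : finType) : T -> R := fun=> (#|T|%:R)^-1.

Definition pmf_conv (G : groupType) (p q : G -> R) : G -> R :=
  fun g => fine (\esum_(h in [set: G]) (p h * q (h^-1 * g)%g)%:E).

Fixpoint pmf_convn (G : groupType) (p : G -> R) (n : nat) : G -> R :=
  if n is m.+1 then pmf_conv p (pmf_convn p m) else fun g => (g == 1%g)%:R.

(* The condition says that 1 is the only common divisor of the return times. *)
Definition aperiodic (G : groupType) (mu : G -> R) : Prop :=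
  forall d : nat,
    (forall K : nat, (1 <= K)%N -> 0 < pmf_convn mu K 1%g -> (d %| K)%N) ->
    d = 1%N.

Definition switch_walk_switch (A : zmodType) (F : finGroupType)
    (mu : wreath A F -> R) : Prop :=
  exists nu : A -> R,
    [/\ is_pmf nu, forall a, nu (- a) = nu a &
      let muF := pmf_image (@lamp_emb A F) (@uniform_pmf F) in
      let muA := pmf_image (@base_emb A F) nu in
      mu = pmf_conv (pmf_conv muF muA) muF].

End MassFunctions.

Section WordLength.
Variables (G : groupType) (S : set G).

Definition product_of_length (k : nat) (g : G) : Prop :=
  exists s : seq G, [/\ size s = k,
    forall x, x \in s -> S x \/ S (x^-1)%g & g = (\prod_(x <- s) x)%g].

Definition generates : Prop := forall g, exists k, product_of_length k g.

(* The least [k] such that [g] is a product of [k] elements of [S] or their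
   inverses (the default value 0 is irrelevant when [S] generates [G]). *)
Definition word_length (g : G) : nat :=
  xget 0%N [set k | product_of_length k g /\
                    forall j, product_of_length j g -> (k <= j)%N].

End WordLength.

Section AlmostInvariance.
Variables (R : realType) (G : groupType) (S : set G) (mu : G -> R).

Definition drift (n : nat) : R :=
  fine (\esum_(g in [set: G]) ((word_length S g)%:R * pmf_convn mu n g)%:E).

Definition individually_almost_invariant (r : nat -> R) : Prop :=
  forall (eps : R) (g : nat -> G), 0 < eps ->
    (forall n, (word_length S (g n))%:R <= r n) ->
    exists V : nat -> set G, \forall n \near \oo,
      1 - eps <= mass (pmf_convn mu n) (V n) /\
      forall h, V n h -> 0 < pmf_convn mu n h /\
        `|pmf_convn mu n (h * g n)%g / pmf_convn mu n h - 1| <= eps.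

Definition invariance_radius_succeq (r : nat -> R) : Prop :=
  forall r2 : nat -> R, (forall n, 0 <= r2 n) ->
    (fun n => r2 n / r n) @ \oo --> (0 : R) ->
    individually_almost_invariant r2.

End AlmostInvariance.

(* Main.v *)
Require Import Defs.
From mathcomp Require Import all_boot all_order all_algebra all_fingroup.
From mathcomp Require Import finmap.
From mathcomp Require Import all_classical all_reals all_analysis.
From mathcomp Require Import ring lra zify.

(** Write X for the projected walk on the plane.  Just after a visit of the walker
    the lamp of a site is uniform, so given X the lamps on the range are independent
    and uniform, and the law at time n is an average, over the paths of X, of averages
    over the lamps of the sites visited ([iter_sws]).

    Stop at time n - T and suppose that the square of radius 2T around the walker has
    already been visited.  During the last T steps the walker stays in this square,
    where every lamp is already uniform: these steps move the walker and leave the law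
    of the lamps unchanged.  Multiplying on the right by an element g of word length r,
    with r much smaller than T, only changes lamps in the square, which is invisible
    after averaging, and moves the end point by O(r).  The law of X at time T changes
    by at most O(r / sqrt T) in total variation under such a translation
    ([gradient_norm1]).  Hence the law at time n is almost invariant under g in total
    variation as soon as r is small compared to sqrt T and the square is covered with
    high probability ([sws_path_translate]), and the pointwise form follows
    ([almost_invariant_of_translation]).

    By reversal of time, the square has to be covered around the starting point.  Started
    at 0 and run for a time equal to a large power of D, the walk visits a given site at
    distance at most D with probability at least 1 / 2.  When D is a power of log n it
    then comes back to 0 within sqrt n steps, except with probability
    O(log log n / log n).  Of the order of log log n such rounds fit in the time n and
    are enough to visit all the O(D^2) sites with high probability ([covering]).  With T
    of order (log n)^4 the scale sqrt T is of order (log n)^2.  On the other hand the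
    drift L(n) is at least a constant times the expected size of the range, itself at
    least n divided by the Green function G(n) = O(log n) ([expected_range_ge],
    [drift_ge]); so n / L(n) = O(log n) is negligible compared to sqrt T.

    All the estimates on X come from one gradient bound ([gradient_bound]), of order
    1 / sqrt n.  The indicator of the origin is a mixed second difference of the
    indicator of a quadrant, so two gradient bounds give the decay 1 / n of the
    transition kernel, and two more bound its second differences by 1 / n^2.  These
    yield G(n) = O(log n) and a bound O(log |x|) for the difference between the Green
    functions at 0 and at x; a lower bound of order log n on G(n) comes from the fact
    that X stays within O(sqrt n) of its starting point.  The inequality G(x) <= P(x hits 0) G(0)
    turns these into bounds on hitting probabilities. *)

Set Implicit Arguments.
Unset Strict Implicit.
Unset Printing Implicit Defensive.

Import Order.TTheory GRing.Theory Num.Theory.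
Import numFieldNormedType.Exports.

Local Open Scope ring_scope.

(** * Expectations over words of independent letters *)

Section Expectation.
Variables (R : rcfType) (T : eqType) (st : seq T) (nu : T -> R).

Fixpoint expect (n : nat) (phi : seq T -> R) : R :=
  if n is m.+1 then \sum_(s <- st) nu s * expect m (fun w => phi (s :: w))
  else phi [::].

Lemma eq_expect n phi psi :
  (forall w, size w = n -> phi w = psi w) -> expect n phi = expect n psi.
Proof.
elim: n phi psi => [|n IH] phi psi h /=; first exact: h.
by apply: eq_bigr => s _; congr (_ * _); apply: IH => w sw; apply: h; rewrite /= sw.
Qed.

Lemma expectD n phi psi :
  expect n (fun w => phi w + psi w) = expect n phi + expect n psi.
Proof.
elim: n phi psi => [//|n IH] phi psi /=.
by rewrite -big_split; apply: eq_bigr => s _ /=; rewrite IH mulrDr.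
Qed.

Lemma expectZ n a phi : expect n (fun w => a * phi w) = a * expect n phi.
Proof.
elim: n phi => [//|n IH] phi /=.
by rewrite mulr_sumr; apply: eq_bigr => s _ /=; rewrite IH mulrCA.
Qed.

Lemma expectB n phi psi :
  expect n (fun w => phi w - psi w) = expect n phi - expect n psi.
Proof.
rewrite expectD; congr (_ + _); rewrite -[RHS]mulN1r -expectZ.
by apply: eq_expect => w _; rewrite mulN1r.
Qed.

Lemma expect_sum n (I : Type) (r : seq I) (P : pred I) (phi : I -> seq T -> R) :
  expect n (fun w => \sum_(i <- r | P i) phi i w) =
  \sum_(i <- r | P i) expect n (phi i).
Proof.
elim: r => [|i r IH].
  rewrite big_nil -[RHS](mul0r (expect n (fun=> 0))) -expectZ.
  by apply: eq_expect => w _; rewrite big_nil mul0r.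
rewrite big_cons -IH; case: ifP => Pi.
  by rewrite -expectD; apply: eq_expect => w _; rewrite big_cons Pi.
by apply: eq_expect => w _; rewrite big_cons Pi.
Qed.

Lemma expect_cat m n phi :
  expect (m + n) phi = expect m (fun u => expect n (fun v => phi (u ++ v))).
Proof.
elim: m phi => [//|m IH] phi /=.
by apply: eq_bigr => s _; rewrite IH.
Qed.

(** Independent letters are exchangeable: a walk and its reversal have the same law. *)
Lemma expect_rev n phi : expect n (fun w => phi (rev w)) = expect n phi.
Proof.
elim: n phi => [//|n IH] phi.
rewrite -[in RHS]addn1 expect_cat /=.
under [RHS]eq_expect => u _ do
  (under eq_bigr => s _ do rewrite cats1; idtac).
rewrite expect_sum; apply: eq_bigr => s _; rewrite expectZ -[in RHS]IH.
by congr (_ * _); apply: eq_expect => w _; rewrite rev_cons.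
Qed.

Hypothesis nu_ge0 : forall s, 0 <= nu s.
Hypothesis nu_sum1 : \sum_(s <- st) nu s = 1.

Lemma expect_cst n a : expect n (fun=> a) = a.
Proof. by elim: n => [//|n IH] /=; rewrite IH -mulr_suml nu_sum1 mul1r. Qed.

(** The comparison may be restricted to words over the alphabet; this is how bounds
    that use the boundedness of the steps enter. *)
Lemma le_expect n phi psi :
  (forall w, size w = n -> {subset w <= st} -> phi w <= psi w) ->
  expect n phi <= expect n psi.
Proof.
elim: n phi psi => [|n IH] phi psi h /=; first by apply: h.
rewrite big_seq [leRHS]big_seq; apply: ler_sum => s sst.
apply: ler_wpM2l => //; apply: IH => w sw wst.
apply: h; rewrite /= ?sw // => x; rewrite inE => /predU1P[->//|]; exact: wst.
Qed.

Lemma expect_ge0 n phi : (forall w, 0 <= phi w) -> 0 <= expect n phi.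
Proof. by move=> h; rewrite -(expect_cst n 0); apply: le_expect. Qed.

Lemma expect_le_cst n phi a :
  (forall w, size w = n -> {subset w <= st} -> phi w <= a) -> expect n phi <= a.
Proof. by move=> h; rewrite -(expect_cst n a); apply: le_expect. Qed.

Lemma ler_norm_expect n phi : `|expect n phi| <= expect n (fun w => `|phi w|).
Proof.
rewrite ler_norml -mulN1r -expectZ; apply/andP; split; apply: le_expect => w _ _.
  by rewrite mulN1r lerNl ler_normr lexx orbT.
exact: ler_norm.
Qed.

(** The variance is nonnegative. *)
Lemma sqr_expect_le n phi :
  (expect n phi) ^+ 2 <= expect n (fun w => phi w ^+ 2).
Proof.
set a := expect n phi.
have : 0 <= expect n (fun w => (phi w - a) ^+ 2) by apply: expect_ge0 => w; exact: sqr_ge0.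
suff -> : expect n (fun w => (phi w - a) ^+ 2) =
          expect n (fun w => phi w ^+ 2) - a ^+ 2 by rewrite subr_ge0.
rewrite (@eq_expect _ _ (fun w => (phi w ^+ 2 - (2%:R * a) * phi w) + a ^+ 2)); last first.
  by move=> w _; ring.
rewrite expectD expect_cst expectB expectZ -/a; ring.
Qed.

(** Centred independent variables are orthogonal, so that their variances add up. *)
Lemma expect_sqr_sum (xi : T -> R) n :
  \sum_(s <- st) nu s * xi s = 0 ->
  expect n (fun w => (\sum_(s <- w) xi s) ^+ 2) =
  n%:R * \sum_(s <- st) nu s * xi s ^+ 2.
Proof.
move=> xi0; have E1 m : expect m (fun w => \sum_(s <- w) xi s) = 0.
  elim: m => [|m IH] /=; first by rewrite big_nil.
  under eq_bigr => s _ do (under eq_expect => w _ do rewrite big_cons;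
     rewrite expectD expect_cst IH addr0; idtac).
  by [].
elim: n => [|n IH] /=; first by rewrite big_nil expr0n mul0r.
rewrite -natr1 mulrDl mul1r -IH addrC -[X in _ + X]mul1r -nu_sum1 mulr_suml -big_split.
apply: eq_bigr => s _ /=; rewrite -mulrDr; congr (_ * _).
rewrite (@eq_expect _ _ (fun w => xi s ^+ 2 + (2%:R * xi s) * (\sum_(j <- w) xi j)
                                  + (\sum_(j <- w) xi j) ^+ 2)).
  by rewrite !expectD expectZ E1 mulr0 addr0 expect_cst.
by move=> w _; rewrite big_cons; ring.
Qed.

End Expectation.

(** * Random walks on an abelian group *)

Section Walk.
Variables (R : rcfType) (V : zmodType) (st : seq V) (nu : V -> R).
Local Notation expect := (expect st nu).

(** Acting on functions rather than on measures keeps every sum finite: bounds on the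
    transition probabilities are obtained by applying this operator to indicators. *)
Definition walk_op (n : nat) (f : V -> R) (x : V) : R :=
  expect n (fun w => f (x + \sum_(s <- w) s)).

Definition shift_diff (a : V) (f : V -> R) (x : V) : R := f x - f (x + a).

Lemma eq_walk_op n f g x : f =1 g -> walk_op n f x = walk_op n g x.
Proof. by move=> fg; apply: eq_expect => w _; rewrite fg. Qed.

Lemma walk_opS n f x :
  walk_op n.+1 f x = \sum_(s <- st) nu s * walk_op n f (x + s).
Proof.
apply: eq_bigr => s _; congr (_ * _).
by apply: eq_expect => w _; rewrite big_cons addrA.
Qed.

Lemma walk_opD m n f x : walk_op (m + n) f x = walk_op m (walk_op n f) x.
Proof.
rewrite /walk_op expect_cat; apply: eq_expect => u _; apply: eq_expect => v _.
by rewrite big_cat addrA.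
Qed.

Lemma walk_op_shift n f a x :
  walk_op n (fun y => f (y + a)) x = walk_op n f (x + a).
Proof. by apply: eq_expect => w _; rewrite addrAC. Qed.

Lemma walk_op_shift_diff n a f x : walk_op n (shift_diff a f) x = shift_diff a (walk_op n f) x.
Proof. by rewrite {1}/walk_op expectB /shift_diff -walk_op_shift. Qed.

Hypothesis nu_ge0 : forall s, 0 <= nu s.
Hypothesis nu_sum1 : \sum_(s <- st) nu s = 1.

Hypothesis st_uniq : uniq st.

Section Gradient.
Variable e : V.
Hypotheses (st0 : 0 \in st) (ste : e \in st) (e0 : e != 0).
Hypotheses (nu0 : 0 < nu 0) (nue : 0 < nu e).

Let xi (s : V) : R := (s == 0)%:R / nu 0 - (s == e)%:R / nu e.

Let sum_pick (a : V) (h : V -> R) : a \in st ->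
  \sum_(s <- st) (s == a)%:R * h s = h a.
Proof.
move=> sta; rewrite (bigD1_seq a) //= eqxx mul1r big1 ?addr0 // => s /negPf ->.
by rewrite mul0r.
Qed.

Let sum_xi (h : V -> R) : \sum_(s <- st) nu s * xi s * h s = h 0 - h e.
Proof.
transitivity (\sum_(s <- st) (s == 0)%:R * (nu s * h s / nu 0) -
              \sum_(s <- st) (s == e)%:R * (nu s * h s / nu e)).
  by rewrite -sumrB; apply: eq_bigr => s _; rewrite /xi; ring.
by rewrite !sum_pick //; congr (_ - _); field; rewrite gt_eqF.
Qed.

Let expect_xi n f x :
  expect n (fun w => (\sum_(s <- w) xi s) * f (x + \sum_(s <- w) s)) =
  n%:R * walk_op n.-1 (shift_diff e f) x.
Proof.
elim: n f x => [|n IH] f x; first by rewrite /= big_nil !mul0r.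
transitivity (\sum_(s <- st) (nu s * xi s * walk_op n f (x + s) +
                nu s * (n%:R * walk_op n.-1 (shift_diff e f) (x + s)))).
  apply: eq_bigr => s _; rewrite -mulrA -mulrDr; congr (_ * _).
  rewrite -IH -expectZ -expectD; apply: eq_expect => w _.
  by rewrite !big_cons mulrDl addrA.
rewrite big_split /= sum_xi addr0 -[_ - _]/(shift_diff e (walk_op n f) x).
rewrite -walk_op_shift_diff -natr1 mulrDl mul1r addrC; congr (_ + _).
case: n {IH} => [|n]; first by rewrite mul0r big1 // => s _; rewrite mul0r mulr0.
by rewrite walk_opS mulr_sumr; apply: eq_bigr => s _; rewrite mulrCA.
Qed.

(** Give the weight 1 / nu 0 to the letter 0, the weight - 1 / nu e to the letter e, and
    0 to the others.  Inserting the weight of the letter read at one given time replaces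
    f by its difference along e, whatever the time, since the walk commutes with
    translations.  Averaged over n + 1 times, the difference is the expectation of f at
    the end point times the sum of the weights, divided by n + 1.  The weights being
    centred and independent, the absolute value of their sum has expectation at most
    the square root of (n + 1)(1 / nu 0 + 1 / nu e). *)
Lemma gradient_bound n f b x : (forall y, `|f y| <= b) ->
  `|walk_op n (shift_diff e f) x| <=
    b * Num.sqrt (((nu 0)^-1 + (nu e)^-1) / n.+1%:R).
Proof.
move=> fb; set kappa := _ + _.
have b0 : 0 <= b by apply: le_trans (fb 0).
have n0 : 0 < n.+1%:R :> R by rewrite ltr0n.
have k0 : 0 <= kappa by rewrite addr_ge0 // invr_ge0 ltW.
have E1 : expect n.+1 (fun w => `|\sum_(s <- w) xi s|) <= Num.sqrt (n.+1%:R * kappa).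
  set E := expect _ _.
  have E0 : 0 <= E by apply: expect_ge0.
  rewrite -{1}(ger0_norm E0) -sqrtr_sqr ler_sqrt; last by rewrite mulr_ge0 // ltW.
  apply: (le_trans (sqr_expect_le nu_ge0 nu_sum1 _ _)).
  under eq_expect => w _ do rewrite real_normK ?num_real //.
  rewrite expect_sqr_sum //; last first.
    by under eq_bigr => s _ do rewrite -[_ * _]mulr1; rewrite sum_xi subrr.
  rewrite ler_pM2l //.
  under eq_bigr => s _ do rewrite expr2 mulrA.
  rewrite sum_xi /xi !eqxx eq_sym (negPf e0) !mul0r !mul1r.
  by rewrite subr0 sub0r opprK lexx.
have : n.+1%:R * `|walk_op n (shift_diff e f) x| <= b * Num.sqrt (n.+1%:R * kappa).
  rewrite -{1}[n.+1%:R]normr_nat -normrM -(expect_xi n.+1).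
  apply: le_trans (ler_norm_expect _ nu_ge0 _ _) _.
  apply: le_trans (ler_wpM2l b0 E1); rewrite -expectZ; apply: le_expect => // w _ _.
  by rewrite normrM mulrC ler_wpM2r.
rewrite mulrC -ler_pdivlMr // => /le_trans; apply.
rewrite -mulrA ler_wpM2l // ler_pdivrMr //.
have F (N : R) : 0 < N -> N * kappa = kappa / N * N ^+ 2.
  by move=> N0; field; rewrite gt_eqF.
rewrite F // sqrtrM; last by rewrite divr_ge0 // ltW.
by rewrite sqrtr_sqr normr_nat lexx.
Qed.

End Gradient.

Definition traj (x : V) (w : seq V) : seq V := x :: scanl +%R x w.

(** The target is fixed and the starting point varies, so that the transition kernel is
    [walk_op] applied to a single function. *)
Definition kernel0 (n : nat) (x : V) : R := walk_op n (fun y => (y == 0)%:R) x.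

Definition green (n : nat) (x : V) : R := \sum_(j < n.+1) kernel0 j x.

Lemma kernel0_0 x : kernel0 0 x = (x == 0)%:R.
Proof. by rewrite /kernel0 /walk_op /= big_nil addr0. Qed.

Lemma kernel0_ge0 n x : 0 <= kernel0 n x.
Proof. by apply: expect_ge0. Qed.

Lemma greenS n x :
  green n.+1 x = (x == 0)%:R + \sum_(s <- st) nu s * green n (x + s).
Proof.
rewrite /green big_ord_recl kernel0_0; congr (_ + _).
under eq_bigr => j _ do rewrite /kernel0 walk_opS.
by rewrite exchange_big; apply: eq_bigr => s _; rewrite mulr_sumr.
Qed.

Lemma green_ge1 n : 1 <= green n 0.
Proof.
rewrite /green big_ord_recl kernel0_0 eqxx -[leLHS]addr0; apply: lerD => //.
by apply: sumr_ge0 => j _; exact: kernel0_ge0.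
Qed.

Lemma le_green m n x : (m <= n)%N -> green m x <= green n x.
Proof.
move=> mn; rewrite /green -!(big_mkord xpredT (fun j => kernel0 j x)).
rewrite [leRHS](big_cat_nat (n := m.+1)) //= lerDl sumr_ge0 // => j _; exact: kernel0_ge0.
Qed.

(** Markov property at the first visit to 0: the expected number of visits to 0 is at
    most the probability of a visit times the expected number of visits from 0. *)
Lemma green_le_hit n x :
  green n x <= expect n (fun w => (0 \in traj x w)%:R) * green n 0.
Proof.
elim: n x => [|n IH] x.
  rewrite /green !big_ord1 !kernel0_0 eqxx mulr1 /= /traj /= inE eq_sym //.
case: (eqVneq x 0) => [->|x0].
  rewrite (@eq_expect _ _ _ _ _ _ (fun=> 1)) ?expect_cst ?mul1r // => w _.
  by rewrite /traj mem_head.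
apply: le_trans (ler_wpM2l _ (le_green 0 (leqnSn n))); last by apply: expect_ge0.
rewrite greenS (negPf x0) add0r mulr_suml; apply: ler_sum => s _.
rewrite -mulrA ler_wpM2l //; apply: le_trans (IH _) _.
rewrite ler_wpM2r ?(le_trans ler01 (green_ge1 _)) //.
by apply: le_expect => // w _ _; rewrite /traj /= [in leRHS]in_cons [0 == x]eq_sym (negPf x0).
Qed.

Lemma miss_bound n x :
  expect n (fun w => (0 \notin traj x w)%:R) * green n 0 <= green n 0 - green n x.
Proof.
have -> : expect n (fun w => (0 \notin traj x w)%:R) =
          1 - expect n (fun w => (0 \in traj x w)%:R).
  rewrite -{2}(expect_cst nu_sum1 n 1) -expectB; apply: eq_expect => w _.
  by case: (_ \in _); rewrite ?subrr ?subr0.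
by rewrite mulrBl mul1r lerB // green_le_hit.
Qed.

End Walk.

(** * The plane and its five steps *)

Local Notation Z2 := (int * int)%type.

Definition steps : seq Z2 := [:: (0, 0); (1, 0); (-1, 0); (0, 1); (0, -1)].

Definition norm1 (z : Z2) : nat := (`|z.1| + `|z.2|)%N.

Lemma norm1N (z : Z2) : norm1 (- z) = norm1 z.
Proof. by rewrite /norm1 /= !abszN. Qed.

Lemma norm1D (y z : Z2) : (norm1 (y + z)%R <= norm1 y + norm1 z)%N.
Proof. rewrite /norm1 /=; lia. Qed.

Lemma norm1_sum_steps w : {subset w <= steps} -> (norm1 (\sum_(s <- w) s)%R <= size w)%N.
Proof.
elim: w => [|s w IH] h; first by rewrite big_nil.
rewrite big_cons /= -add1n; apply: leq_trans (norm1D _ _) _; apply: leq_add.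
  by move: (h s (mem_head _ _)); rewrite !inE => /or4P[|||/orP[]] /eqP->.
by apply: IH => y yw; apply: h; rewrite inE yw orbT.
Qed.

Definition segment (r : nat) : seq int := [seq i%:Z - r%:Z | i <- iota 0 (r.*2.+1)].

Definition box (r : nat) : seq Z2 := [seq (a, b) | a <- segment r, b <- segment r].

Lemma mem_segment r (a : int) : (a \in segment r) = (`|a| <= r)%N.
Proof.
apply/mapP/idP => [[i]|ar]; first by rewrite mem_iota => ? ->; lia.
by exists (absz (a + r%:Z)); rewrite ?mem_iota; lia.
Qed.

Lemma mem_box r z : (z \in box r) = (`|z.1| <= r)%N && (`|z.2| <= r)%N.
Proof.
case: z => a b /=; apply/allpairsP/andP => [[[c d] /= [cr dr [-> ->]]]|[ar br]].
  by rewrite -!mem_segment.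
by exists (a, b); rewrite /= !mem_segment.
Qed.

Lemma box_uniq r : uniq (box r).
Proof.
have u : uniq (segment r).
  by rewrite map_inj_uniq ?iota_uniq // => i j /addIr [].
by apply: allpairs_uniq => // -[a b] [c d].
Qed.

Lemma size_box r : size (box r) = (r.*2.+1 ^ 2)%N.
Proof. by rewrite size_allpairs size_map size_iota mulnn. Qed.

Record step_law (R : rcfType) (nu : Z2 -> R) : Prop := StepLaw {
  law_gt0 : forall s, s \in steps -> 0 < nu s;
  law_ge0 : forall s, 0 <= nu s;
  law_sum1 : \sum_(s <- steps) nu s = 1;
  law_sym : forall s, nu (- s) = nu s }.

Section PlanarWalk.
Variables (R : rcfType) (nu : Z2 -> R).
Hypothesis law : step_law nu.

Let nu_gt0 := law_gt0 law.
Let nu_ge0 := law_ge0 law.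
Let nu_sum1 := law_sum1 law.
Let nuN := law_sym law.

Local Notation expect := (expect steps nu).
Local Notation P := (walk_op steps nu).
Local Notation kernel0 := (kernel0 steps nu).

Lemma sum_stepsN (h : Z2 -> R) :
  \sum_(s <- steps) nu s * h (- s) = \sum_(s <- steps) nu s * h s.
Proof.
have E (a b : int) : nu (- a, - b) = nu (a, b) by rewrite -(nuN (a, b)).
rewrite !big_cons !big_nil -![- (_, _)]/(- _, - _) /= !oppr0 opprK.
have -> : nu (-1, 0) = nu (1, 0) by rewrite -(E 1 0).
have -> : nu (0, -1) = nu (0, 1) by rewrite -(E 0 1).
ring.
Qed.

Lemma expect_opp n phi : expect n (fun w => phi [seq - s | s <- w]) = expect n phi.
Proof.
elim: n phi => [//|n IH] phi /=; rewrite -[RHS]sum_stepsN.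
by apply: eq_bigr => s _; rewrite -[in RHS]IH.
Qed.

Lemma kernel0_sym n x : kernel0 n (- x) = kernel0 n x.
Proof.
rewrite /kernel0 /walk_op -expect_opp; apply: eq_expect => w _.
by rewrite big_map sumrN -opprD oppr_eq0.
Qed.

Lemma kernel0E n x : kernel0 n x = expect n (fun w => (\sum_(s <- w) s == x)%:R).
Proof.
rewrite -kernel0_sym; apply: eq_expect => w _.
by rewrite addrC subr_eq0.
Qed.

(** One constant that serves in [gradient_bound] for both coordinate directions. *)
Definition kappa : R := (nu 0)^-1 + (nu (1, 0))^-1 + (nu (0, 1))^-1.

Let inv_ge0 s : 0 <= (nu s)^-1.
Proof. by rewrite invr_ge0. Qed.

Lemma kappa_ge0 : 0 <= kappa.
Proof. by rewrite !addr_ge0. Qed.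

Definition grad_rate (n : nat) : R := Num.sqrt (kappa / n.+1%:R).

Let grad_le (a : Z2) (c : R) := forall n f b x, (forall y, `|f y| <= b) ->
  `|P n (shift_diff a f) x| <= c * (b * grad_rate n).

Let grad_le_unit e : e \in steps -> e != 0 -> (nu 0)^-1 + (nu e)^-1 <= kappa ->
  grad_le e 1.
Proof.
move=> es e0 ek n f b x fb; rewrite mul1r.
have z : (0 : Z2) \in steps by [].
apply: le_trans (gradient_bound nu_ge0 nu_sum1 isT z es e0 (nu_gt0 z) (nu_gt0 es) n x fb) _.
apply: ler_wpM2l; first by apply: le_trans (fb 0).
by apply: ler_wsqrtr; rewrite ler_wpM2r // invr_ge0.
Qed.

Let grad_leD a c b d : grad_le a c -> grad_le b d -> grad_le (a + b) (c + d).
Proof.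
move=> ac bd n f r x fr.
have -> : P n (shift_diff (a + b) f) x = P n (shift_diff a f) x + P n (shift_diff b f) (x + a).
  by rewrite !walk_op_shift_diff /shift_diff !addrA; ring.
by rewrite mulrDl; apply: le_trans (ler_normD _ _) _; apply: lerD; [exact: ac|exact: bd].
Qed.

Let grad_leN a c : grad_le a c -> grad_le (- a) c.
Proof.
move=> ac n f r x fr.
have -> : P n (shift_diff (- a) f) x = - P n (shift_diff a f) (x - a).
  by rewrite !walk_op_shift_diff /shift_diff !subrK; ring.
by rewrite normrN; exact: ac.
Qed.

(** A translation by a is a product of [norm1 a] translations by unit vectors. *)
Lemma gradient_norm1 a n f b x : (forall y, `|f y| <= b) ->
  `|P n (shift_diff a f) x| <= (norm1 a)%:R * (b * grad_rate n).
Proof.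
have Z0 : grad_le 0 0.
  move=> {}n {}f {}b {}x _; rewrite walk_op_shift_diff /shift_diff addr0 subrr normr0.
  by rewrite mul0r.
have D (e : Z2) (m : nat) : grad_le e 1 -> grad_le (e *+ m) m%:R.
  move=> e1; elim: m => [|m IH]; first by rewrite mulr0n.
  by rewrite mulrS mulrSr addrC; exact: grad_leD.
have DZ (e : Z2) (m : int) : grad_le e 1 -> grad_le (e *~ m) (absz m)%:R.
  move=> e1; case: m => m; first exact: D.
  by rewrite NegzE mulrNz abszN; apply/grad_leN/D.
have H : grad_le (1, 0) 1.
  by apply: grad_le_unit => //; rewrite lerDl.
have V : grad_le (0, 1) 1.
  by apply: grad_le_unit => //; rewrite /kappa addrAC lerDl.
have aE : a = (1, 0) *~ a.1 + (0, 1) *~ a.2.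
  have Mn (u v : int) (k : nat) : ((u, v) : Z2) *+ k = (u *+ k, v *+ k).
    by elim: k => [//|k IH]; rewrite !mulrS IH.
  have Mz (u v k : int) : ((u, v) : Z2) *~ k = (u *~ k, v *~ k).
    by case: k => k; rewrite ?NegzE ?mulrNz -?pmulrn !Mn.
  by case: a => a1 a2; rewrite !Mz /= !mul0rz; congr (_, _) => /=; rewrite ?addr0 ?add0r intz.
by rewrite {1}aE natrD; apply: grad_leD; apply: DZ.
Qed.

End PlanarWalk.

(** * Upper bounds on the planar kernel *)

Section KernelBounds.
Variables (R : rcfType) (nu : Z2 -> R).
Hypothesis law : step_law nu.

Let nu_ge0 := law_ge0 law.
Let nu_sum1 := law_sum1 law.

Local Notation P := (walk_op steps nu).
Local Notation kernel0 := (kernel0 steps nu).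
Local Notation green := (green steps nu).
Local Notation kappa := (kappa nu).
Local Notation grad_rate := (grad_rate nu).

Let quadrant (y : Z2) : R := ((0 <= y.1) && (0 <= y.2))%:R.

(** This is what makes [gradient_bound] give pointwise bounds on the kernel: the
    indicator of the origin is obtained from a bounded function by two differences, each
    of which gains a factor [grad_rate]. *)
Let quadrantE y : (y == 0)%:R = shift_diff (-1, 0) (shift_diff (0, -1) quadrant) y.
Proof.
case: y => a b; rewrite /shift_diff /quadrant -[(a, b) == 0]/((a == 0) && (b == 0)) /=.
rewrite addr0 !addr0.
have -> : (0 <= a - 1) = (0 <= a) && (a != 0) by lia.
have -> : (0 <= b - 1) = (0 <= b) && (b != 0) by lia.
by case: (ltgtP 0 a) => //= _; case: (ltgtP 0 b) => //= _; rewrite ?subrr ?subr0.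
Qed.

Let quadrant_le y : `|quadrant y| <= 1.
Proof. by rewrite normr_nat lern1 leq_b1. Qed.

Let walk_op_shift_diffD i j a f x : P (i + j) (shift_diff a f) x = P i (shift_diff a (P j f)) x.
Proof. by rewrite walk_opD; apply: eq_walk_op => y; rewrite walk_op_shift_diff. Qed.

Lemma grad_rate_ge0 n : 0 <= grad_rate n.
Proof. exact: sqrtr_ge0. Qed.

Let grad_rate_le (c j n : nat) : (j.+1 <= c * n.+1)%N ->
  grad_rate n <= Num.sqrt (c%:R * kappa / j.+1%:R).
Proof.
move=> jc; apply: ler_wsqrtr; rewrite ler_pdivrMr ?ltr0n // mulrAC ler_pdivlMr ?ltr0n //.
by rewrite [leRHS]mulrAC [leRHS]mulrC ler_wpM2l ?(kappa_ge0 law) // -natrM ler_nat.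
Qed.

Let eq_shift_diff a (f g : Z2 -> R) : f =1 g -> shift_diff a f =1 shift_diff a g.
Proof. by move=> fg x; rewrite /shift_diff !fg. Qed.

Lemma kernel0_le j x : kernel0 j x <= 2%:R * kappa / j.+1%:R.
Proof.
have [i [k [jik i2 k2]]] : exists i k, [/\ j = i + k, j.+1 <= 2 * i.+1 & j.+1 <= 2 * k.+1]%N.
  exists j./2, (uphalf j); split; lia.
rewrite -[leLHS](ger0_norm (kernel0_ge0 nu_ge0 nu_sum1 _ _)) /kernel0 //.
rewrite (eq_walk_op _ _ _ _ quadrantE) jik walk_op_shift_diffD.
apply: le_trans (gradient_norm1 law _ _ _ (b := grad_rate k) _) _.
  move=> y; apply: le_trans (gradient_norm1 law _ _ _ quadrant_le) _.
  by rewrite !mul1r.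
rewrite -jik mul1r; set B := _ / _.
have B0 : 0 <= B by rewrite divr_ge0 // mulr_ge0 // (kappa_ge0 law).
rewrite -[leRHS](sqr_sqrtr B0) expr2.
by apply: ler_pM; rewrite ?grad_rate_ge0 //; apply: grad_rate_le.
Qed.

(** By symmetry twice the left-hand side is a second difference of the kernel.  With the
    two differences of [quadrantE] this makes four, and each of them is bounded over one
    quarter of the time. *)
Lemma kernel0_lag j x :
  kernel0 j 0 - kernel0 j x <= (norm1 x)%:R ^+ 2 * (8%:R * kappa ^+ 2 / j.+1%:R ^+ 2).
Proof.
suff H : (kernel0 j 0 - kernel0 j x) * 2%:R <=
    (norm1 x)%:R ^+ 2 * (4%:R * kappa / j.+1%:R) ^+ 2.
  rewrite -(ler_pM2r (ltr0n R 2)); apply: le_trans H _.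
  by rewrite le_eqVlt; apply/orP; left; apply/eqP; rewrite -exprVn; ring.
have -> : (kernel0 j 0 - kernel0 j x) * 2%:R =
    P j (shift_diff x (shift_diff (- x) (fun y => (y == 0)%:R))) 0.
  rewrite walk_op_shift_diff {1}/shift_diff !walk_op_shift_diff /shift_diff.
  rewrite !add0r subrr; have := kernel0_sym law j x; rewrite /kernel0 => ->; ring.
pose i := (j %/ 4)%N; pose k := (j - 3 * i)%N.
have jE : j = (i + (i + (i + k)))%N by rewrite /i /k; lia.
have i4 : (j.+1 <= 4 * i.+1)%N by rewrite /i; lia.
have k4 : (j.+1 <= 4 * k.+1)%N by rewrite /i /k; lia.
apply: le_trans (ler_norm _) _.
have -> : P j (shift_diff x (shift_diff (- x) (fun y => (y == 0)%:R))) 0 =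
  P i (shift_diff x (P i (shift_diff (- x) (P i
      (shift_diff (-1, 0) (P k (shift_diff (0, -1) quadrant))))))) 0.
  rewrite {1}jE walk_op_shift_diffD; apply/eq_walk_op/eq_shift_diff => y.
  rewrite walk_op_shift_diffD; apply/eq_walk_op/eq_shift_diff => z.
  by rewrite (eq_walk_op _ _ _ _ quadrantE) walk_op_shift_diffD.
have g0 := grad_rate_ge0; have x0 : 0 <= (norm1 x)%:R :> R by [].
apply: le_trans (gradient_norm1 law _ _ _
    (b := (norm1 x)%:R * (grad_rate i * grad_rate k * grad_rate i)) _) _.
  move=> y; apply: le_trans (gradient_norm1 law _ _ _ (b := grad_rate i * grad_rate k) _) _ => //.
    move=> z; apply: le_trans (gradient_norm1 law _ _ _ (b := grad_rate k) _) _.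
      move=> t; apply: le_trans (gradient_norm1 law _ _ _ quadrant_le) _.
      by rewrite !mul1r.
    by rewrite mul1r mulrC.
  by rewrite norm1N.
set B := _ / _; have B0 : 0 <= B by rewrite divr_ge0 // mulr_ge0 // (kappa_ge0 law).
rewrite [leLHS](_ : _ = (norm1 x)%:R ^+ 2 * 
  (grad_rate i * grad_rate k * grad_rate i * grad_rate i)); last by ring.
rewrite ler_wpM2l ?exprn_ge0 //.
rewrite -[B](sqr_sqrtr B0).
have Bi : grad_rate i <= Num.sqrt B by apply: grad_rate_le.
have Bk : grad_rate k <= Num.sqrt B by apply: grad_rate_le.
rewrite [leRHS](_ : _ = Num.sqrt B * Num.sqrt B * Num.sqrt B * Num.sqrt B); last by ring.
by do 3! [apply: ler_pM; rewrite ?mulr_ge0 ?grad_rate_ge0 //].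
Qed.

Lemma harmonic_dyadic a : \sum_(j < 2 ^ a) j.+1%:R^-1 <= a.+1%:R :> R.
Proof.
elim: a => [|a IH]; first by rewrite big_ord1 invr1.
rewrite expnS mul2n -addnn big_split_ord /= -(natr1 a.+1); apply: lerD => //.
have a0 : (0 : R) < (2 ^ a)%:R by rewrite ltr0n expn_gt0.
apply: (@le_trans _ _ (\sum_(j < 2 ^ a) ((2 ^ a)%:R^-1 : R))); last first.
  by rewrite sumr_const card_ord -[leLHS]mulr_natr mulVf ?gt_eqF.
apply: ler_sum => j _; rewrite lef_pV2 ?posrE ?ltr0n ?expn_gt0 // ler_nat; lia.
Qed.

Lemma sum_inv_sqr M n : (0 < M)%N ->
  \sum_(j < n) (M + j).+1%:R ^- 2 <= M%:R^-1 :> R.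
Proof.
move=> M0; suff H : \sum_(j < n) (M + j).+1%:R ^- 2 <= M%:R^-1 - (M + n)%:R^-1 :> R.
  by apply: le_trans H _; rewrite gerBl invr_ge0.
elim: n => [|n IH]; first by rewrite big_ord0 addn0 subrr.
rewrite big_ord_recr /= addnS -natr1; set x : R := (M + n)%:R.
have x0 : 0 < x by rewrite ltr0n; lia.
apply: le_trans (lerD IH (lexx _)) _; rewrite -/x -subr_ge0.
have -> : M%:R^-1 - (x + 1)^-1 - (M%:R^-1 - x^-1 + (x + 1) ^- 2) =
  x^-1 * (x + 1) ^- 2 by field; rewrite !gt_eqF ?ltr0n //; lra.
by rewrite mulr_ge0 ?invr_ge0 ?exprn_ge0 //; lra.
Qed.

Lemma green_le n a : (n < 2 ^ a)%N -> green n 0 <= 2%:R * kappa * a.+1%:R.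
Proof.
move=> na; have k0 : 0 <= 2%:R * kappa by rewrite mulr_ge0 // (kappa_ge0 law).
apply: le_trans (ler_wpM2l k0 (harmonic_dyadic a)).
rewrite mulr_sumr /green.
rewrite -!(big_mkord xpredT (fun j => kernel0 j 0)).
rewrite -!(big_mkord xpredT (fun j => 2%:R * kappa * j.+1%:R^-1)).
rewrite [leRHS](big_cat_nat (n := n.+1)) //= -[leLHS]addr0; apply: lerD.
  by apply: ler_sum => j _; apply: kernel0_le.
by apply: sumr_ge0 => j _; rewrite mulr_ge0 // invr_ge0.
Qed.

(** Up to the time 4 ^ i the kernel is bounded by a harmonic sum, hence the factor i.
    After this time the bound of [kernel0_lag] is summable and its sum 4 ^ - i
    compensates the square of [norm1 x]. *)
Lemma green_lag n i x : (norm1 x <= 2 ^ i)%N ->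
  green n 0 - green n x <= (2%:R * kappa + 8%:R * kappa ^+ 2) * (i.*2.+1)%:R.
Proof.
move=> xi.
(* the diffusive time scale for the distance 2 ^ i *)
set M := (2 ^ i.*2)%N.
have M0 : (0 < M)%N by rewrite expn_gt0.
have k0 : 0 <= kappa by apply: kappa_ge0 law.
have d0 j : 0 <= 2%:R * kappa / j.+1%:R by rewrite divr_ge0 // mulr_ge0.
have e0 j : 0 <= 8%:R * kappa ^+ 2 / j.+1%:R ^+ 2.
  by rewrite divr_ge0 // ?exprn_ge0 // mulr_ge0 // exprn_ge0.
have far m : \sum_(j < m) (kernel0 (M + j) 0 - kernel0 (M + j) x) <= 8%:R * kappa ^+ 2.
  have x2 : (norm1 x)%:R ^+ 2 <= M%:R :> R.
    by rewrite -natrX ler_nat /M -muln2 expnM leq_exp2r.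
  apply: (@le_trans _ _ (M%:R * (8%:R * kappa ^+ 2 * \sum_(j < m) (M + j).+1%:R ^- 2))).
    rewrite !mulr_sumr; apply: ler_sum => j _.
    by apply: le_trans (kernel0_lag _ _) _; rewrite ler_wpM2r.
  rewrite mulrCA -[leRHS]mulr1 ler_wpM2l ?mulr_ge0 ?exprn_ge0 //.
  by rewrite mulrC -ler_pdivlMr ?ltr0n // mul1r sum_inv_sqr.
have one_le : 1 <= (i.*2.+1)%:R :> R by rewrite ler1n.
have AB : 2%:R * kappa * (i.*2.+1)%:R + 8%:R * kappa ^+ 2 <=
    (2%:R * kappa + 8%:R * kappa ^+ 2) * (i.*2.+1)%:R.
  by rewrite [leRHS]mulrDl lerD2l ler_peMr // mulr_ge0 // exprn_ge0.
apply: le_trans AB.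
have near m : (m < M)%N -> green m 0 - green m x <= 2%:R * kappa * (i.*2.+1)%:R.
  move=> mM; apply: le_trans (green_le mM); rewrite gerBl.
  by apply: sumr_ge0 => j _; apply: kernel0_ge0.
have [nM|Mn] := ltnP n M.
  apply: le_trans (near _ nM) _; rewrite lerDl.
  by rewrite mulr_ge0 // exprn_ge0.
have -> : green n 0 - green n x = (green M.-1 0 - green M.-1 x) +
    \sum_(j < n.+1 - M) (kernel0 (M + j) 0 - kernel0 (M + j) x).
  rewrite /green -!sumrB prednK // -!(big_mkord xpredT (fun j => kernel0 j 0 - kernel0 j x)).
  rewrite -(big_mkord xpredT (fun j => kernel0 (M + j) 0 - kernel0 (M + j) x)).
  rewrite (big_cat_nat (n := M)) //=; last by rewrite ltnW.
  congr (_ + _); rewrite -{1}[M]add0n big_addn.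
  by apply: eq_bigr => j _; rewrite addnC.
by apply: lerD; [apply: near; rewrite prednK|apply: far].
Qed.

End KernelBounds.

(** * Lower bound on the planar Green function *)

Section GreenLowerBound.
Variables (R : rcfType) (nu : Z2 -> R).
Hypothesis law : step_law nu.

Let nu_ge0 := law_ge0 law.
Let nu_sum1 := law_sum1 law.

Local Notation expect := (expect steps nu).
Local Notation kernel0 := (kernel0 steps nu).
Local Notation green := (green steps nu).

Lemma sum_eq_box r z : \sum_(x <- box r) (z == x)%:R = (z \in box r)%:R :> R.
Proof.
have [zr|zr] := boolP (z \in box r); last first.
  by rewrite big_seq big1 // => x xr; case: eqVneq => // zx; rewrite zx xr in zr.
rewrite (bigD1_seq z) ?box_uniq //= eqxx big1 ?addr0 // => x /negPf.
by rewrite eq_sym => ->.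
Qed.

Lemma sum_kernel0_box r k : \sum_(x <- box r) kernel0 k x =
  expect k (fun w => ((\sum_(s <- w) s)%R \in box r)%:R).
Proof.
under eq_bigr => x _ do rewrite (kernel0E law).
by rewrite -expect_sum; apply: eq_expect => w _; rewrite sum_eq_box.
Qed.

Let expect_coord k (xi : Z2 -> R) : (forall s, xi (- s) = - xi s) ->
  expect k (fun w => (\sum_(s <- w) xi s) ^+ 2) =
  k%:R * \sum_(s <- steps) nu s * xi s ^+ 2.
Proof.
move=> xiN; apply: expect_sqr_sum => //; set S := \sum_(s <- _) _.
have : S = - S.
  by rewrite {1}/S -(sum_stepsN law xi) -sumrN; apply: eq_bigr => s _; rewrite xiN mulrN.
lra.
Qed.

(** Chebyshev: the squares of the two coordinates add up to at most the time on average. *)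
Lemma box_mass r k : (k.*2 <= r ^ 2)%N -> (0 < r)%N ->
  2%:R^-1 <= \sum_(x <- box r) kernel0 k x.
Proof.
move=> kr r0; pose x1 (s : Z2) : R := s.1%:~R; pose x2 (s : Z2) : R := s.2%:~R.
have r2 : 0 < r%:R ^+ 2 :> R by rewrite exprn_gt0 // ltr0n.
rewrite sum_kernel0_box.
have sumE (i : Z2 -> int) : i 0 = 0 -> {morph i : x y / x + y} ->
   forall w, (i (\sum_(s <- w) s))%:~R = \sum_(s <- w) (i s)%:~R :> R.
  move=> i0 iD; elim=> [|s w IH]; first by rewrite !big_nil i0.
  by rewrite !big_cons iD intrD IH.
have out z : 1 - (x1 z ^+ 2 + x2 z ^+ 2) / r%:R ^+ 2 <= (z \in box r)%:R.
  have [zr|] := boolP (z \in box r).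
    by rewrite gerBl divr_ge0 // ?addr_ge0 ?sqr_ge0 // ltW.
  rewrite mem_box negb_and subr_le0 ler_pdivlMr // mul1r => zr.
  have big (c : int) : (`|c| > r)%N -> r%:R ^+ 2 <= c%:~R ^+ 2 :> R.
    move=> cr; rewrite -[leRHS]real_normK ?num_real // -intr_norm.
    by rewrite ler_sqr ?nnegrE // pmulrn ler_int; lia.
  move: zr; rewrite -!ltnNge => /orP[/big|/big] h; apply: le_trans h _.
    by rewrite lerDl sqr_ge0.
  by rewrite lerDr sqr_ge0.
apply: le_trans (le_expect nu_ge0 (fun w _ _ => out _)).
rewrite expectB expect_cst //.
under eq_expect => w _ do rewrite mulrC /x1 /x2 !sumE //.
rewrite expectZ expectD !expect_coord; first last.
- by move=> s; rewrite /= intrN.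
- by move=> s; rewrite /= intrN.
rewrite -mulrDr -big_split /=.
under eq_bigr => s _ do rewrite -mulrDr.
set v := \sum_(s <- _) _.
have v1 : v <= 1.
  rewrite -nu_sum1 /v big_seq [leRHS]big_seq; apply: ler_sum => s ss.
  rewrite -[leRHS]mulr1 ler_wpM2l //; move: ss.
  by rewrite !inE => /or4P[|||/orP[]] /eqP-> /=;
    rewrite ?mulrN1z ?sqrrN ?expr1n ?expr0n ?addr0 ?add0r.
have : r%:R ^-2 * (k%:R * v) <= 2%:R^-1.
  rewrite mulrC ler_pdivrMr //; apply: (@le_trans _ _ k%:R).
    by rewrite -[leRHS]mulr1 ler_wpM2l.
  rewrite mulrC ler_pdivlMr // -natrX -natrM ler_nat; lia.
lra.
Qed.

(** The return probability at an even time is the sum of the squares of the kernel at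
    half the time, and half of the mass of the latter lies in a box. *)
Lemma kernel0_even_ge r k : (k.*2 <= r ^ 2)%N -> (0 < r)%N ->
  (4 * r.*2.+1 ^ 2)%:R^-1 <= kernel0 k.*2 0.
Proof.
move=> kr r0; have half := box_mass kr r0.
apply: (@le_trans _ _ (\sum_(x <- box r) kernel0 k x ^+ 2)); last first.
  rewrite -addnn /kernel0 walk_opD.
  apply: (@le_trans _ _ (expect k (fun w =>
      \sum_(x <- box r) kernel0 k x * (\sum_(s <- w) s == x)%:R))).
    rewrite expect_sum; apply: ler_sum => x _.
    by rewrite expectZ -(kernel0E law) expr2.
  apply: le_expect => // w _ _; rewrite add0r.
  set z := \sum_(s <- w) s.
  rewrite (eq_bigr (fun x => kernel0 k z * (z == x)%:R)); last first.
    by move=> x _; case: eqVneq => [->|]; rewrite ?mulr0.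
  by rewrite -mulr_sumr sum_eq_box ler_piMr ?kernel0_ge0 // lern1 leq_b1.
set B : R := (r.*2.+1 ^ 2)%:R; have B0 : 0 < B by rewrite ltr0n expn_gt0.
(* Instead of Cauchy-Schwarz: q ^ 2 >= 2 l q - l ^ 2 for the mean value l of q. *)
pose l := (2%:R * B)^-1.
have l0 : 0 <= l by rewrite invr_ge0 mulr_ge0 // ltW.
apply: (@le_trans _ _ (\sum_(x <- box r) (2%:R * l * kernel0 k x - l ^+ 2))); last first.
  apply: ler_sum => x _; rewrite -subr_ge0.
  have -> : kernel0 k x ^+ 2 - (2%:R * l * kernel0 k x - l ^+ 2) = (kernel0 k x - l) ^+ 2 by ring.
  exact: sqr_ge0.
rewrite sumrB -mulr_sumr big_const_seq count_predT iter_addr_0 size_box.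
rewrite -[_ *+ (_ ^ 2)]mulr_natr -/B.
apply: (@le_trans _ _ (2%:R * l * 2%:R^-1 - l ^+ 2 * B)); last first.
  by rewrite lerD2r ler_wpM2l // mulr_ge0.
rewrite natrM -/B /l le_eqVlt; apply/orP; left; apply/eqP.
by move: (B) B0 => b b0; field; rewrite gt_eqF.
Qed.

(** Every block of times from 4 ^ a to 4 ^ (a + 1) contributes at least a constant. *)
Lemma green_ge i : i%:R / 200%:R <= green (4 ^ i) 0.
Proof.
pose E i := \sum_(0 <= k < 2 * 4 ^ i) kernel0 k.*2 0.
have EG n : \sum_(0 <= k < n) kernel0 k.*2 0 <= \sum_(0 <= j < n.*2) kernel0 j 0.
  elim: n => [|n IH]; first by rewrite !big_geq.
  rewrite doubleS big_nat_recr //= [leRHS]big_nat_recr //= -[leLHS]addr0.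
  by apply: lerD; rewrite ?kernel0_ge0 // big_nat_recr //= lerD2r.
have E_ge a : a.+1%:R / 200%:R <= E a.
  elim: a => [|a IH].
    apply: (@le_trans _ _ (kernel0 0 0)); first by rewrite kernel0_0 eqxx /=; lra.
    by rewrite /E big_ltn //= lerDl sumr_ge0 // => k _; apply: kernel0_ge0.
  rewrite /E (big_cat_nat (n := (2 * 4 ^ a)%N)) //=; last first.
    by rewrite leq_mul2l leq_exp2l // leqnSn.
  rewrite -(natr1 a.+1) mulrDl; apply: lerD IH _.
  set r := (2 ^ (a + 2))%N.
  have r2 : (r ^ 2 = 16 * 4 ^ a)%N by rewrite -expnM mulnC expnM expnD mulnC.
  apply: (@le_trans _ _ (\sum_(2 * 4 ^ a <= k < 2 * 4 ^ a.+1) (4 * r.*2.+1 ^ 2)%:R^-1)).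
    rewrite sumr_const_nat -[leRHS]mulr_natr [leRHS]mulrC ler_pdivlMr ?ltr0n ?muln_gt0 ?expn_gt0 //.
    rewrite mul1r mulrC ler_pdivrMr // -natrM ler_nat.
    have : (0 < 4 ^ a)%N by rewrite expn_gt0.
    rewrite (expnS 4 a); move: (4 ^ a)%N r2 => x r2 x0.
    have : (r <= 4 * x)%N.
      by rewrite -(leq_exp2r _ _ (isT : 0 < 2)%N) r2 expnMn leq_mul2l -mulnn leq_pmulr.
    by rewrite -mulnn; move: r2; rewrite -mulnn; nia.
  apply: ler_sum_nat => k /andP[_ k2]; apply: kernel0_even_ge; rewrite ?expn_gt0 //.
  rewrite r2; move: k2; rewrite expnS; lia.
case: i => [|i]; first by rewrite mul0r (le_trans ler01) // green_ge1.


apply: le_trans (E_ge i) _; apply: le_trans (EG _) _.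
rewrite /green -(big_mkord xpredT (fun j => kernel0 j 0)).
rewrite [leRHS](big_cat_nat (n := (2 * 4 ^ i).*2)) //=; last by rewrite expnS; lia.
by rewrite lerDl sumr_ge0 // => j _; apply: kernel0_ge0.
Qed.

End GreenLowerBound.

(** * Covering a set by repeated attempts *)

Section Trajectory.
Variable V : zmodType.
Implicit Types (x z : V) (u v w : seq V).

Lemma traj_cons x s w : traj x (s :: w) = x :: traj (x + s) w.
Proof. by []. Qed.

Lemma trajP z x w :
  reflect (exists2 i, (i <= size w)%N & z = x + \sum_(s <- take i w) s)
          (z \in traj x w).
Proof.
apply: (iffP idP) => [|[i iw ->]].
  elim: w x => [|s w IH] x.
    by rewrite inE => /eqP->; exists 0%N; rewrite //= big_nil addr0.
  rewrite traj_cons inE => /predU1P[->|/IH[i iw ->]].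
    by exists 0%N; rewrite //= big_nil addr0.
  by exists i.+1; rewrite //= big_cons addrA.
elim: w x i iw => [|s w IH] x [|i] //= iw; rewrite ?big_nil ?addr0 ?mem_head //.
by rewrite traj_cons big_cons addrA inE IH ?orbT.
Qed.

Lemma traj_catl x u v : {subset traj x u <= traj x (u ++ v)}.
Proof.
move=> z /trajP[i iu ->]; apply/trajP; exists i.
  by rewrite size_cat (leq_trans iu) ?leq_addr.
by rewrite takel_cat.
Qed.

Lemma traj_catr x u v : {subset traj (x + \sum_(s <- u) s) v <= traj x (u ++ v)}.
Proof.
move=> z /trajP[i iv ->]; apply/trajP; exists (size u + i)%N.
  by rewrite size_cat leq_add2l.
by rewrite takeD take_size_cat // drop_size_cat // big_cat addrA.
Qed.

Lemma mem_traj_cat x z u v : z \in traj x (u ++ v) ->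
  (z \in traj x u) || (z \in traj (x + \sum_(s <- u) s) v).
Proof.
move=> /trajP[i iuv ->]; case: (leqP i (size u)) => [iu|ui].
  by apply/orP; left; apply/trajP; exists i; rewrite ?takel_cat.
apply/orP; right; apply/trajP; exists (i - size u)%N.
  by rewrite leq_subLR -size_cat.
by rewrite take_cat ltnNge (ltnW ui) /= big_cat addrA.
Qed.

Lemma traj_shift z a x w : (z + a \in traj (x + a) w) = (z \in traj x w).
Proof.
by apply/trajP/trajP => -[i iw e]; exists i => //; [apply: (addIr a)|];
   rewrite ?e addrAC.
Qed.

(** Seen from its end point, a walk visits the same set as its reversal does from 0. *)
Lemma traj_rev z w : (\sum_(s <- w) s - z \in traj 0 w) = (z \in traj 0 (rev w)).
Proof.
have H u y : y \in traj 0 u -> \sum_(s <- u) s - y \in traj 0 (rev u).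
  move=> /trajP[i iu ->]; apply/trajP; exists (size u - i)%N.
    by rewrite size_rev leq_subr.
  rewrite take_rev subKn // !add0r (perm_big _ (permEl (perm_rev _))) /=.
  by rewrite -{1}(cat_take_drop i u) big_cat addrC addKr.
apply/idP/idP => [/H|/H]; first by rewrite subKr.
by rewrite revK (perm_big _ (permEl (perm_rev _))).
Qed.

(** The part of the walk that follows its first visit to 0. *)
Fixpoint after_hit x w : option (seq V) :=
  if x == 0 then Some w else if w is s :: w' then after_hit (x + s) w' else None.

Lemma after_hit_traj x w v : after_hit x w = Some v -> {subset traj 0 v <= traj x w}.
Proof.
elim: w x => [|s w IH] x /=; case: eqVneq => [->|_] //; try by move=> [->].
by move=> /IH h z /h zw; rewrite traj_cons inE zw orbT.
Qed.

(** Completion of k rounds, each of which lets the walk run for the time t and then waits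
    for the next visit to 0.  Each round starts afresh at 0, so that k rounds are k
    independent attempts to visit any given site. *)
Fixpoint attempts (t k : nat) w : bool :=
  if k is k'.+1 then
    (t <= size w)%N &&
    oapp (attempts t k') false (after_hit (\sum_(s <- take t w) s) (drop t w))
  else true.

Lemma attempts_cat t k u v : size u = t ->
  attempts t k.+1 (u ++ v) = oapp (attempts t k) false (after_hit (\sum_(s <- u) s) v).
Proof. by move=> <-; rewrite /= size_cat leq_addr take_size_cat // drop_size_cat. Qed.

End Trajectory.

Section Covering.
Variables (R : rcfType) (V : zmodType) (st : seq V) (nu : V -> R).
Hypothesis nu_ge0 : forall s, 0 <= nu s.
Hypothesis nu_sum1 : \sum_(s <- st) nu s = 1.
Local Notation expect := (expect st nu).

(** A bound that holds at all times holds after the random time of the first visit. *)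
Let expect_after_hit m psi B x : 0 <= B -> (forall n, expect n psi <= B) ->
  expect m (fun w => oapp psi 0 (after_hit x w)) <= B.
Proof.
move=> B0 psiB; elim: m x => [|m IH] x.
  by rewrite /=; case: eqVneq => //= _; exact: (psiB 0%N).
have [->|x0] := eqVneq x 0.
  by rewrite (eq_expect _ _ (psi := psi)) // => -[|s w] _; rewrite /= eqxx.
rewrite /= (negPf x0) -[B]mul1r -nu_sum1 mulr_suml.
by apply: ler_sum => s _; rewrite ler_wpM2l.
Qed.

Lemma attempts_fail_le t k m z q : 0 <= q ->
  expect t (fun w => (z \notin traj 0 w)%:R) <= q ->
  expect m (fun w => (attempts t k w && (z \notin traj 0 w))%:R) <= q ^+ k.
Proof.
move=> q0 zq; elim: k m => [|k IH] m.
  by rewrite expr0; apply: expect_le_cst => // w _ _; rewrite lern1 leq_b1.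
have [mt|tm] := ltnP m t.
  rewrite (eq_expect _ _ (psi := fun=> 0)) ?expect_cst ?exprn_ge0 // => w sw.
  by rewrite /= sw leqNgt mt.
rewrite -(subnKC tm) expect_cat exprS.
apply: le_trans (ler_wpM2r _ zq); last by rewrite exprn_ge0.
rewrite mulrC -expectZ; apply: le_expect => // u su _.
set x := \sum_(s <- u) s.
pose psi w : R := (attempts t k w && (z \notin traj 0 w))%:R.
apply: (@le_trans _ _ ((z \notin traj 0 u)%:R *
   expect (m - t) (fun v => oapp psi 0 (after_hit x v)))); last first.
  rewrite mulrC ler_wpM2r //; apply: expect_after_hit => //; exact: exprn_ge0.
rewrite -expectZ; apply: le_expect => // v _ _; rewrite attempts_cat // -/x.
have [zu|zu] := boolP (z \in traj 0 u).
  by rewrite (traj_catl _ zu) andbF mul0r.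
rewrite mul1r; case E: (after_hit x v) => [v'|//]; rewrite /= /psi ler_nat.
case: (attempts t k v') => //=.
have [zv|_] := boolP (z \in traj 0 v'); last by rewrite leq_b1.
by rewrite traj_catr // add0r (after_hit_traj E).
Qed.

(** Here a walk that never comes back is counted as a failure, whence the extra term;
    the time s allotted to the return leaves at least n steps to the rest. *)
Let expect_no_hit m n s x psi B : 0 <= B ->
  (forall w, 0 <= psi w <= 1) -> (forall k, (n <= k)%N -> expect k psi <= B) ->
  (s + n <= m)%N ->
  expect m (fun w => oapp psi 1 (after_hit x w)) <=
  expect s (fun w => (0 \notin traj x w)%:R) + B.
Proof.
move=> B0 psi01 psiB; elim: s m x => [|s IH] m x snm.
  have [x0|x0] := eqVneq x 0.
    rewrite (eq_expect _ _ (psi := psi)); last by rewrite x0 => -[|? ?] _; rewrite /= eqxx.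
    by apply: le_trans (psiB _ snm) _; rewrite lerDr expect_ge0.
  rewrite [X in _ <= X + _]/= inE eq_sym (negPf x0).
  apply: (@le_trans _ _ 1); last by rewrite lerDl.
  apply: expect_le_cst => // w _ _.
  by case: after_hit => //= v; case/andP: (psi01 v).
have [x0|x0] := eqVneq x 0.
  rewrite (eq_expect _ _ (psi := psi)); last by rewrite x0 => -[|? ?] _; rewrite /= eqxx.
  apply: le_trans (psiB _ _) _; first lia.
  by rewrite lerDr expect_ge0.
case: m snm => [//|m] snm; rewrite /= (negPf x0).
rewrite -[B]mul1r -[X in _ + X * B]nu_sum1 mulr_suml -big_split /=; apply: ler_sum => a _.
rewrite -mulrDr ler_wpM2l //; apply: le_trans (IH m _ _) _; first lia.
rewrite lerD2r; apply: le_expect => // w _ _.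
by rewrite traj_cons [in leRHS]in_cons [0 == x]eq_sym (negPf x0).
Qed.

Lemma attempts_incomplete_le t s k m eta : 0 <= eta ->
  (forall u, size u = t -> {subset u <= st} ->
     expect s (fun w => (0 \notin traj (\sum_(a <- u) a) w)%:R) <= eta) ->
  (k * (t + s) <= m)%N ->
  expect m (fun w => (~~ attempts t k w)%:R) <= k%:R * eta.
Proof.
move=> eta0 small; elim: k m => [|k IH] m km.
  by rewrite mul0r; apply: expect_le_cst.
have tm : (t <= m)%N by lia.
rewrite -(subnKC tm) expect_cat; apply: expect_le_cst => // u su ust.
rewrite -natr1 mulrDl mul1r addrC; apply: le_trans (lerD (small u su ust) (lexx _)).
have -> : expect (m - t) (fun v => (~~ attempts t k.+1 (u ++ v))%:R) =
  expect (m - t) (fun v => oapp (fun w => (~~ attempts t k w)%:R) 1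
                               (after_hit (\sum_(a <- u) a) v)).
  apply: eq_expect => v _; rewrite attempts_cat //.
  by case: after_hit.
apply: (expect_no_hit (n := (k * (t + s))%N)) => //.
- by rewrite mulr_ge0.
- by move=> w; rewrite ler0n lern1 leq_b1.
- by rewrite mulSn in km; lia.
Qed.

(** The success of the k rounds is a single event for all the targets in L, so that the
    union bound over L is only paid on the second, exponentially small term. *)
Lemma uncovered_le t s k m q eta (L : seq V) : 0 <= q -> 0 <= eta ->
  (forall z, z \in L -> expect t (fun w => (z \notin traj 0 w)%:R) <= q) ->
  (forall u, size u = t -> {subset u <= st} ->
     expect s (fun w => (0 \notin traj (\sum_(a <- u) a) w)%:R) <= eta) ->
  (k * (t + s) <= m)%N ->
  expect m (fun w => (~~ all [in traj 0 w] L)%:R) <= k%:R * eta + (size L)%:R * q ^+ k.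
Proof.
move=> q0 eta0 hq heta km.
apply: le_trans (lerD (attempts_incomplete_le eta0 heta km) (lexx _)).
apply: (@le_trans _ _ (expect m (fun w => (~~ attempts t k w)%:R +
    \sum_(z <- L) (attempts t k w && (z \notin traj 0 w))%:R))).
  apply: le_expect => // w _ _; case: (attempts t k w) => /=; last first.
    by rewrite big1 ?addr0 // lern1 leq_b1.
  rewrite add0r -has_predC; case: hasP => [[z zL /= zw]|_]; last by rewrite sumr_ge0.
  rewrite /=.
  by rewrite (big_rem z) //= zw lerDl sumr_ge0.
rewrite expectD expect_sum lerD2l.
apply: (@le_trans _ _ (\sum_(z <- L) q ^+ k)).
  rewrite big_seq [leRHS]big_seq; apply: ler_sum => z zL.
  exact: attempts_fail_le (hq z zL).
by rewrite big_const_seq count_predT iter_addr_0 -[leLHS]mulr_natl.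
Qed.

End Covering.

(** * The scales of the covering argument *)

Lemma cube_le_exp l : (l.+1 ^ 3 <= 27 * 2 ^ l)%N.
Proof.
elim: l => [//|l IH]; case: (ltnP l 3) => [|l3].
  by case: l {IH} => [|[|[|]]].
rewrite (expnS 2); move: IH; rewrite !(expnS _ 2) !(expnS _ 1) !expn1; move: (2 ^ l)%N => x; nia.
Qed.

(** The rounds of [covering] followed by the last 16 ^ l steps fit in 2 ^ (2 ^ l) steps. *)
Lemma attempts_fit K l : (2 <= K)%N -> (108 * K + 2 <= l)%N ->
  (9 * l * (4 ^ (K * l.+1) + 4 ^ (2 ^ (l - 2))) + 16 ^ l <= 2 ^ (2 ^ l))%N.
Proof.
move=> K2 Kl; have [j lj] : exists j, l = (j + 2)%N by exists (l - 2)%N; lia.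
have Kj : (K * l.+1 <= 2 ^ j)%N.
  have := cube_le_exp l; rewrite {2}lj expnD -mulnn !(expnS _ 2) !(expnS _ 1) !expn1.
  move: (2 ^ j)%N => x; nia.
have -> : (2 ^ (2 ^ l) = 4 ^ (2 ^ j) * 4 ^ (2 ^ j))%N.
  by rewrite -expnD addnn -mul2n -[4%N]/(2 ^ 2)%N -expnM -!expnS lj addn2.
rewrite lj addnK -lj.
have t_s : (4 ^ (K * l.+1) <= 4 ^ (2 ^ j))%N by rewrite leq_exp2l.
have T_s : (16 ^ l <= 4 ^ (2 ^ j))%N.
  by rewrite -[16%N]/(4 ^ 2)%N -expnM leq_exp2l //; nia.
have l_T : (18 * l + 1 <= 16 ^ l)%N.
  have : (2 <= l)%N by lia.
  elim: (l) => [//|[|[|n]] IH] // _; rewrite expnS; move: (IH isT); lia.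
move: (4 ^ _)%N (4 ^ _)%N (16 ^ l)%N t_s T_s l_T => t s T; nia.
Qed.

Section CoveringScale.
Variables (R : rcfType) (nu : Z2 -> R).
Hypothesis law : step_law nu.

Let nu_ge0 := law_ge0 law.
Let nu_sum1 := law_sum1 law.

Local Notation expect := (expect steps nu).
Local Notation green := (green steps nu).

Definition lag_cst : R := 2%:R * kappa nu + 8%:R * kappa nu ^+ 2.

Lemma lag_cst_ge0 : 0 <= lag_cst.
Proof. by have k0 := kappa_ge0 law; rewrite addr_ge0 // mulr_ge0 // exprn_ge0. Qed.

(** Through [miss_bound] this is [green_lag] divided by [green_ge]. *)
Lemma miss_origin i j x : (norm1 x <= 2 ^ i)%N -> (0 < j)%N ->
  expect (4 ^ j) (fun w => (0 \notin traj x w)%:R) <=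
    200%:R * lag_cst * (i.*2.+1)%:R / j%:R.
Proof.
move=> xi j0; have g0 : 0 < green (4 ^ j) 0 by rewrite (lt_le_trans ltr01) // green_ge1.
have := le_trans (miss_bound nu_ge0 nu_sum1 _ _) (green_lag law (4 ^ j) xi).
have j0' : 0 < j%:R :> R by rewrite ltr0n.
set e := expect _ _; rewrite -/lag_cst => eg; rewrite ler_pdivlMr //.
have e0 : 0 <= e by apply: expect_ge0.
have := ler_wpM2l e0 (green_ge law j); set X := _ * _ in eg *.
move=> H; have := le_trans H eg; rewrite mulrA ler_pdivrMr // => H2.
by apply: le_trans H2 _; rewrite le_eqVlt; apply/orP; left; apply/eqP; ring.
Qed.

(** The first term accounts for the rounds that do not return to 0 in time, the second one
    for the sites missed by all the rounds, and 27 is the constant of [cube_le_exp]. *)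
Definition cover_cst (K : nat) : R :=
  27%:R * (9%:R * (4000%:R * lag_cst * K%:R) + 64%:R).

Let cover_cst_factor_ge0 (K : nat) :
  0 <= 9%:R * (4000%:R * lag_cst * K%:R) + 64%:R :> R.
Proof.
apply: addr_ge0; last exact: ler0n.
apply: mulr_ge0; first exact: ler0n.
apply: mulr_ge0; last exact: ler0n.
apply: mulr_ge0; [exact: ler0n | exact: lag_cst_ge0].
Qed.

Lemma cover_cst_ge0 K : 0 <= cover_cst K.
Proof. apply: mulr_ge0; [exact: ler0n | exact: cover_cst_factor_ge0]. Qed.

(** By reversal the box to be covered is centred at the starting point.  It has
    O(2 ^ (8l)) points, and 9l rounds of length 4 ^ (K (l + 1)) are made.  The choice of
    K makes each round miss a given point with probability at most 1 / 2, so that a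
    point is left out with probability O(2 ^ - l).  The waiting time 4 ^ (2 ^ (l - 2))
    makes each return fail with probability O(l / 2 ^ l), that is O(l ^ 2 / 2 ^ l) in
    all. *)
Lemma covering K l m : (2 <= K)%N -> 3200%:R * lag_cst <= K%:R ->
  (108 * K + 2 <= l)%N -> (2 ^ (2 ^ l) <= m + 16 ^ l)%N ->
  expect m (fun w => (~~ all (fun z => \sum_(s <- w) s - z \in traj 0 w)
                            (box (2 * 16 ^ l)))%:R) <=
    cover_cst K / l.+1%:R.
Proof.
rewrite /cover_cst => K2 KC Kl lm; have C0 := lag_cst_ge0.
have K0 : 0 < K%:R :> R by rewrite ltr0n; lia.
have l0 : 0 < l.+1%:R :> R by rewrite ltr0n.
have l2 : (2 <= l)%N by apply: leq_trans Kl; rewrite leq_addl.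
rewrite -expect_rev.
rewrite (eq_expect _ _ (psi := fun w => (~~ all [in traj 0 w] (box (2 * 16 ^ l)))%:R)); last first.
  move=> w _; congr (~~ _)%:R; apply: eq_all => z /=.
  by rewrite traj_rev revK.
set D := (2 * 16 ^ l)%N; pose t := (4 ^ (K * l.+1))%N; pose s := (4 ^ (2 ^ (l - 2)))%N.
pose eta : R := 200%:R * lag_cst * ((K * l.+1).*2.*2.+1)%:R / (2 ^ (l - 2))%:R.
have eta0 : 0 <= eta by rewrite divr_ge0 // !mulr_ge0.
have hq z : z \in box D -> expect t (fun w => (z \notin traj 0 w)%:R) <= 2%:R^-1.
  rewrite mem_box => zD.
  rewrite (eq_expect _ _ (psi := fun w => (0 \notin traj (- z) w)%:R)); last first.
    by move=> w _; rewrite -(traj_shift z (- z) 0) subrr add0r.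
  have zi : (norm1 (- z) <= 2 ^ (4 * l + 2))%N.
    have -> : (2 ^ (4 * l + 2) = 4 * 16 ^ l)%N by rewrite expnD expnM mulnC.
    case/andP: zD => z1 z2; rewrite norm1N (leq_trans (leq_add z1 z2)) // /D.
    by rewrite -mulnDl.
  apply: le_trans (miss_origin zi _) _; first by rewrite muln_gt0 (ltnW K2).
  rewrite natrM invfM mulrA mulrAC ler_pdivrMr // ler_pdivrMr //.
  have : ((4 * l + 2).*2.+1)%:R <= 8%:R * l.+1%:R :> R by rewrite -natrM ler_nat; clear; lia.
  move: ((_.*2.+1)%:R : R) (l.+1%:R : R) l0 => a b b0 ab.
  nra.
have heta u : size u = t -> {subset u <= steps} ->
    expect s (fun w => (0 \notin traj (\sum_(a <- u) a) w)%:R) <= eta.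
  move=> su ust; apply: miss_origin; last by rewrite expn_gt0.
  apply: leq_trans (norm1_sum_steps ust) _.
  by rewrite su /t -mul2n (expnM 2 2).
have half0 : 0 <= 2%:R^-1 :> R by rewrite invr_ge0.
apply: le_trans (uncovered_le (k := (9 * l)%N) nu_ge0 nu_sum1 half0 eta0 hq heta _) _.
  by rewrite -(leq_add2r (16 ^ l)); apply: leq_trans (attempts_fit K2 Kl) lm.
have X0 : 0 < (2 ^ l)%:R :> R by rewrite ltr0n expn_gt0.
have cube : l.+1%:R ^+ 2 / (2 ^ l)%:R <= 27%:R / l.+1%:R :> R.
  rewrite ler_pdivrMr // mulrAC ler_pdivlMr // -exprSr -natrX -natrM ler_nat.
  exact: cube_le_exp.
set A : R := _ + 64%:R.
have A0 : 0 <= A by exact: cover_cst_factor_ge0.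
apply: (@le_trans _ _ (A * (l.+1%:R ^+ 2 / (2 ^ l)%:R))); last first.
  have -> : 27%:R * A / l.+1%:R = A * (27%:R / l.+1%:R) by ring.
  by rewrite ler_wpM2l.
rewrite /A mulrDl; apply: lerD.
  have -> : eta = 800%:R * lag_cst * ((K * l.+1).*2.*2.+1)%:R / (2 ^ l)%:R.
    have -> : (2 ^ l = 4 * 2 ^ (l - 2))%N by rewrite -(expnD 2 2) subnKC.
    by rewrite /eta natrM; field; rewrite gt_eqF // ltr0n expn_gt0.
  rewrite !mulrA ler_pM2r ?invr_gt0 //.
  rewrite [leLHS](_ : _ = lag_cst * (9 * l * (K * l.+1).*2.*2.+1 * 800)%:R); last first.
    by rewrite !natrM; ring.
  rewrite [leRHS](_ : _ = lag_cst * (9 * (4000 * K * (l.+1 * l.+1)))%:R); last first.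
    by rewrite !natrM; ring.
  rewrite ler_wpM2l // ler_nat.
  have : (l * (K * l.+1).*2.*2.+1 <= 5 * K * (l.+1 * l.+1))%N by clear -K2; nia.
  by move: (_.+1)%N (l.+1 * l.+1)%N => b c; clear; nia.
rewrite size_box; apply: (@le_trans _ _ (64%:R / (2 ^ l)%:R)); last first.
  by rewrite ler_wpM2l // ler_peMl ?invr_ge0 ?ler0n // -natrX ler1n expn_gt0.
rewrite exprVn ler_pdivrMr ?exprn_gt0 // mulrAC ler_pdivlMr // -!natrX -!natrM ler_nat.
have -> : (2 ^ (9 * l) = (16 ^ l) ^ 2 * 2 ^ l)%N.
  by rewrite -[16%N]/(2 ^ 4)%N -!expnM -expnD; congr (2 ^ _)%N; clear; lia.
rewrite mulnA leq_mul2r -[64%N]/(8 ^ 2)%N -expnMn leq_exp2r // /D.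
have : (0 < 16 ^ l)%N by rewrite expn_gt0.
move: (16 ^ l)%N => x x0; apply/orP; right; clear -x0; lia.
Qed.

End CoveringScale.

(** * Averaging over lamps *)

Section Lamps.
Variables (R : rcfType) (A : zmodType) (F : finGroupType).
Local Notation G := (wreath A F).
Implicit Types (f : G -> R) (g h : G) (z : A) (b : F) (L : seq A).

Lemma mul_pos g h : (g * h)%g.1 = g.1 + h.1.
Proof. by []. Qed.

Lemma mul_lamp g h z : (g * h)%g.2 z = (g.2 z * h.2 (z - g.1))%g.
Proof. exact: wreath_mulE. Qed.

Lemma base_emb_lamp (a : A) z : (base_emb F a).2 z = 1%g.
Proof. by rewrite fsfunE. Qed.

Lemma lamp_emb_lamp b z : (lamp_emb A b).2 z = if z == 0 then b else 1%g.
Proof. by rewrite fsfunE inE. Qed.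

Definition move_by (a : A) h : G := (h * base_emb F a)%g.

Lemma move_by_pos (a : A) h : (move_by a h).1 = h.1 + a.
Proof. by []. Qed.

Lemma move_by_lamp a h z : (move_by a h).2 z = h.2 z.
Proof. by rewrite mul_lamp base_emb_lamp mulg1. Qed.

Lemma move_byD (a c : A) h : move_by a (move_by c h) = move_by (c + a) h.
Proof.
apply: wreathP => [|z]; last by rewrite !move_by_lamp.
exact: (esym (addrA _ _ _)).
Qed.

Lemma move_by0 h : move_by 0 h = h.
Proof. by apply: wreathP => [|z]; rewrite ?move_by_lamp // move_by_pos addr0. Qed.

(** Lamps are addressed by their absolute position rather than relatively to the walker,
    so that changes at distinct sites commute with each other and with the walk. *)
Definition turn_lamp z b h : G :=
  (h * (base_emb F (z - h.1)) * lamp_emb A b * base_emb F (h.1 - z))%g.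

Lemma turn_lamp_pos z b h : (turn_lamp z b h).1 = h.1.
Proof. by rewrite !mul_pos /= addr0 -[h.1 - z]opprB addrK. Qed.

Lemma turn_lamp_lamp z b h y : (turn_lamp z b h).2 y = (h.2 y * if y == z then b else 1)%g.
Proof.
rewrite !mul_lamp !base_emb_lamp !mulg1 lamp_emb_lamp !mul_pos /=.
by rewrite [h.1 + _]addrC subrK subr_eq0.
Qed.

Lemma turn_lampK z b c h : turn_lamp z b (turn_lamp z c h) = turn_lamp z (c * b)%g h.
Proof.
apply: wreathP => [|y]; rewrite ?turn_lamp_pos // !turn_lamp_lamp.
by case: eqP => _; rewrite ?mulg1 ?mulgA.
Qed.

Lemma turn_lampC y z b c h : y != z ->
  turn_lamp y b (turn_lamp z c h) = turn_lamp z c (turn_lamp y b h).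
Proof.
move=> yz; apply: wreathP => [|t]; rewrite ?turn_lamp_pos // !turn_lamp_lamp.
case: (eqVneq t y) => [->|_]; last by rewrite !mulg1.
by rewrite (negPf yz) !mulg1.
Qed.

Lemma turn_lamp_move_by z b a h : turn_lamp z b (move_by a h) = move_by a (turn_lamp z b h).
Proof.
apply: wreathP => [|y]; first by rewrite turn_lamp_pos 2!move_by_pos turn_lamp_pos.
by rewrite turn_lamp_lamp 2!move_by_lamp turn_lamp_lamp.
Qed.

Definition avg z f h : R := #|F|%:R^-1 * \sum_(b : F) f (turn_lamp z b h).

Definition avgs L f : G -> R := foldr avg f L.

Let F_gt0 : 0 < #|F|%:R :> R.
Proof. by rewrite ltr0n; apply/card_gt0P; exists 1%g. Qed.

Let avg_const (a : R) : #|F|%:R^-1 * \sum_(b : F) a = a.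
Proof. by rewrite sumr_const -[a *+ _]mulr_natl mulKf // gt_eqF. Qed.

Lemma avg_turn_lamp z b f h : avg z f (turn_lamp z b h) = avg z f h.
Proof.
rewrite /avg; congr (_ * _); rewrite [RHS](reindex_inj (mulgI b)).
by apply: eq_bigr => c _; rewrite turn_lampK.
Qed.

Lemma avg_turn_lampr z b f : avg z (fun h => f (turn_lamp z b h)) = avg z f.
Proof.
apply: funext => h; rewrite /avg; congr (_ * _).
rewrite [RHS](reindex_inj (mulIg b)).
by apply: eq_bigr => c _; rewrite turn_lampK.
Qed.

Lemma avg_idem z f : avg z (avg z f) = avg z f.
Proof.
apply: funext => h; rewrite {1}/avg.
by under eq_bigr => b _ do rewrite avg_turn_lamp; rewrite avg_const.
Qed.

Lemma avgC y z f : avg y (avg z f) = avg z (avg y f).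
Proof.
have [->//|yz] := eqVneq y z; apply: funext => h; rewrite /avg.
rewrite -!mulr_sumr exchange_big; congr (_ * (_ * _)).
by apply: eq_bigr => b _; apply: eq_bigr => c _; rewrite turn_lampC // eq_sym.
Qed.

Lemma avg_move_by z a f h : avg z (fun k => f (move_by a k)) h = avg z f (move_by a h).
Proof. by congr (_ * _); apply: eq_bigr => b _; rewrite turn_lamp_move_by. Qed.

Lemma avgs_move_by L a f h : avgs L (fun k => f (move_by a k)) h = avgs L f (move_by a h).
Proof.
elim: L h => [//|z L IH] h /=; rewrite -avg_move_by.
by congr (avg z _ h); apply: funext.
Qed.

Lemma avgsC z L f : avgs L (avg z f) = avg z (avgs L f).
Proof. by elim: L => [//|y L IH] /=; rewrite IH avgC. Qed.

Lemma avgs_absorb z L f : z \in L -> avgs L (avg z f) = avgs L f.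
Proof.
elim: L => [//|y L IH] /=; rewrite inE => /predU1P[<-|/IH->//].
by rewrite avgsC avg_idem.
Qed.

Lemma avgs_sub L L' f : {subset L' <= L} -> avgs L (avgs L' f) = avgs L f.
Proof.
elim: L' f => [//|z L' IH] f sub /=.
rewrite avgs_absorb ?sub ?mem_head // IH // => y yL.
by rewrite sub // inE yL orbT.
Qed.

(** The averages are idempotent and commute, so only the set of sites matters. *)
Lemma eq_avgs L L' f : L =i L' -> avgs L f = avgs L' f.
Proof.
move=> LL; have comm l : avgs l (avgs L' f) = avgs L' (avgs l f).
  by elim: l => [//|z l IH] /=; rewrite IH avgsC.
by rewrite -(avgs_sub f (L := L) (L' := L')) ?comm ?avgs_sub // => z; rewrite LL.
Qed.

Lemma avgs_turn_lampr z b L f : z \in L -> avgs L (fun h => f (turn_lamp z b h)) = avgs L f.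
Proof. by move=> zL; rewrite -(avgs_absorb _ zL) avg_turn_lampr avgs_absorb. Qed.

Lemma eq_in_avgs L f f' h :
  (forall k, k.1 = h.1 -> f k = f' k) -> avgs L f h = avgs L f' h.
Proof.
elim: L h => [|z L IH] h ff /=; first exact: ff.
congr (_ * _); apply: eq_bigr => b _; apply: IH => k kh.
by apply: ff; rewrite kh turn_lamp_pos.
Qed.

Lemma avgsB L f f' h : avgs L (fun k => f k - f' k) h = avgs L f h - avgs L f' h.
Proof.
elim: L h => [//|z L IH] h /=; rewrite /avg.
by under eq_bigr => b _ do rewrite IH; rewrite sumrB mulrBr.
Qed.

Lemma avgs_ge L f c h : (forall k, c <= f k) -> c <= avgs L f h.
Proof.
elim: L h => [//|z L IH] h cf /=; rewrite -(avg_const c).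
by rewrite ler_wpM2l ?invr_ge0 ?(ltW F_gt0) //; apply: ler_sum => b _; exact: IH.
Qed.

Lemma avgs_norm L f c h : (forall k, `|f k| <= c) -> `|avgs L f h| <= c.
Proof.
elim: L h => [//|z L IH] h cf /=; rewrite -[leRHS]avg_const normrM.
rewrite ger0_norm ?invr_ge0 ?(ltW F_gt0) // ler_wpM2l ?invr_ge0 ?(ltW F_gt0) //.
by apply: le_trans (ler_norm_sum _ _ _) _; apply: ler_sum => b _; exact: IH.
Qed.

Lemma avgs_lamp L x h : (2 <= #|F|)%N -> x \in L ->
  2%:R^-1 <= avgs L (fun k => (k.2 x != 1%g)%:R) h.
Proof.
move=> F2 xL; rewrite -(avgs_absorb _ xL); apply: avgs_ge => k.
have F2' : 2%:R <= #|F|%:R :> R by rewrite ler_nat.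
rewrite /avg mulrC ler_pdivlMr //.
have -> : \sum_(b : F) ((turn_lamp x b k).2 x != 1%g)%:R = #|F|%:R - 1 :> R.
  rewrite (bigD1 (k.2 x)^-1%g) //= turn_lamp_lamp eqxx mulgV eqxx add0r.
  rewrite (eq_bigr (fun=> 1)); last first.
    by move=> b bk; rewrite turn_lamp_lamp eqxx -eq_invg_mul eq_sym bk.
  rewrite sumr_const; apply/eqP; rewrite eq_sym subr_eq natr1 eqr_nat.
  rewrite (cardD1 (k.2 x)^-1%g F) inE add1n eqSS; apply/eqP/eq_card => b.
  by rewrite !inE andbT.
lra.
Qed.

(** The change of lamps made by g is a product of changes at sites of L, and each of
    them only permutes the values that are averaged.  Only the motion remains. *)
Lemma avgs_mul L f g h : (forall z, g.2 z != 1%g -> h.1 + z \in L) ->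
  avgs L (fun k => f (k * g)%g) h = avgs L f (move_by g.1 h).
Proof.
move=> gL; pose psi z := g.2 (z - h.1).
pose l := [seq h.1 + z | z <- enum_fset (finsupp g.2)].
pose upds (l : seq A) k := foldr (fun z => turn_lamp z (psi z)) k l.
have upds_pos l' k : (upds l' k).1 = k.1.
  by elim: l' => [//|z l' IH]; rewrite [LHS]turn_lamp_pos IH.
have upds_lamp l' k y : uniq l' ->
    (upds l' k).2 y = (k.2 y * if y \in l' then psi y else 1)%g.
  elim: l' => [_|z l' IH]; first by rewrite mulg1.
  move=> /andP[zl' /IH IHl]; rewrite -[upds (z :: l') k]/(turn_lamp z (psi z) (upds l' k)).
  rewrite turn_lamp_lamp IHl inE.
  by case: eqP => [->|_]; rewrite ?(negPf zl') ?mulg1.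
rewrite (@eq_in_avgs L _ (fun k => f (move_by g.1 (upds l k))) h); last first.
  move=> k kh; congr f; apply: wreathP => [|y]; first by rewrite mul_pos move_by_pos upds_pos.
  rewrite mul_lamp move_by_lamp upds_lamp; last first.
    by rewrite map_inj_uniq ?fset_uniq //; exact: addrI.
  rewrite kh; congr (_ * _)%g; case: mapP => [//|nl].
  apply: fsfun_dflt; apply/negP => yg; apply: nl; exists (y - h.1) => //.
  by rewrite addrC subrK.
have absorb f' l' : {subset l' <= L} -> avgs L (fun k => f' (upds l' k)) = avgs L f'.
  elim: l' f' => [//|z l' IH] f' sub.
  rewrite -(avgs_turn_lampr (psi z) f' (sub _ (mem_head _ _))) -[RHS]IH // => y yl.
  by rewrite sub // inE yl orbT.
rewrite -avgs_move_by -[in RHS](absorb _ l) // => _ /mapP[z zg ->].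
by apply: gL; rewrite -mem_finsupp.
Qed.

End Lamps.

(** * The switch-walk-switch operator *)

Section SwitchWalkSwitch.
Variables (R : rcfType) (A : zmodType) (F : finGroupType).
Variables (st : seq A) (nu : A -> R).
Local Notation G := (wreath A F).
Local Notation expect := (expect st nu).
Implicit Types (f : G -> R) (h : G).

Definition sws f h : R :=
  #|F|%:R^-1 * \sum_(b : F) \sum_(s <- st) nu s *
    (#|F|%:R^-1 * \sum_(c : F) f (h * (lamp_emb A b * base_emb F s * lamp_emb A c))%g).

(** Closed form of the iterates of [sws]: the path is random, and the lamps of all the
    sites of the path are averaged at once. *)
Definition sws_path n f h : R :=
  expect n (fun w => avgs (traj h.1 w) f (move_by (\sum_(s <- w) s) h)).

Lemma turn_lamp_here b h : turn_lamp h.1 b h = (h * lamp_emb A b)%g.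
Proof.
apply: wreathP => [|y]; first by rewrite turn_lamp_pos mul_pos addr0.
by rewrite turn_lamp_lamp mul_lamp lamp_emb_lamp subr_eq0.
Qed.

Lemma swsE f h :
  sws f h = avg h.1 (fun k => \sum_(s <- st) nu s * avg (k.1 + s) f (move_by s k)) h.
Proof.
congr (_ * _); apply: eq_bigr => b _; apply: eq_bigr => s _; congr (_ * (_ * _)).
apply: eq_bigr => c _; congr f.
by rewrite -move_by_pos turn_lamp_here /move_by turn_lamp_here !mulgA.
Qed.

Lemma avg_expect n z (phi : seq A -> G -> R) h :
  avg z (fun k => expect n (fun w => phi w k)) h = expect n (fun w => avg z (phi w) h).
Proof. by rewrite /avg -expect_sum -expectZ. Qed.

Let eq_in_avg z f f' h : (forall k, k.1 = h.1 -> f k = f' k) -> avg z f h = avg z f' h.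
Proof. exact: (eq_in_avgs [:: z]). Qed.

(** The starting point belongs to every path. *)
Lemma avg_sws_path n f h : avg h.1 (sws_path n f) h = sws_path n f h.
Proof.
rewrite (@eq_in_avg _ _ (fun k =>
  expect n (fun w => avgs (traj h.1 w) f (move_by (\sum_(s <- w) s) k))) h).
  rewrite avg_expect; apply: eq_expect => w _.
  by rewrite avg_move_by /= avg_idem.
by move=> k kh; rewrite /sws_path kh.
Qed.

Lemma sws_pathS n f h : sws (sws_path n f) h = sws_path n.+1 f h.
Proof.
(* The first site is averaged by [sws] itself, the others by the rest of the path. *)
pose psi w k := avgs (behead (traj h.1 w)) f (move_by (\sum_(s <- w) s) k).
rewrite swsE (@eq_in_avg _ _ (fun k => expect n.+1 (fun w => psi w k)) h).
  by rewrite avg_expect; apply: eq_expect => w _; rewrite avg_move_by.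
move=> k kh; apply: eq_bigr => s _; congr (_ * _).
rewrite -move_by_pos avg_sws_path; apply: eq_expect => w _.
by rewrite move_byD move_by_pos kh /psi big_cons.
Qed.

Lemma sws_path1 f h : sws f h = sws_path 1 f h.
Proof.
rewrite -sws_pathS !swsE; congr (avg _ _ _); apply: funext => k.
apply: eq_bigr => s _; rewrite -move_by_pos avg_sws_path.
by rewrite /sws_path /= big_nil move_by0.
Qed.

Lemma iter_sws n f h : iter n.+1 sws f h = sws_path n.+1 f h.
Proof.
elim: n h => [|n IH] h; first exact: sws_path1.
by rewrite iterS (funext IH) sws_pathS.
Qed.

End SwitchWalkSwitch.

Section Translation.
Variables (R : rcfType) (F : finGroupType) (nu : Z2 -> R).
Hypothesis law : step_law nu.
Local Notation G := (wreath Z2 F).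
Local Notation expect := (expect steps nu).

Let nu_ge0 := law_ge0 law.
Let nu_sum1 := law_sum1 law.

(** On the event that the box around the position x at time m is covered, the last t
    steps stay in the box and add no new average, and the lamps changed by g lie in the
    box.  What remains is a function of the end point alone, translated by the position
    of g, to which [gradient_norm1] applies over the last t steps. *)
Lemma sws_path_translate m t a (f : G -> R) (g : G) :
  (forall h, `|f h| <= 1) -> (norm1 g.1 <= a)%N ->
  (forall z, g.2 z != 1%g -> (norm1 z <= a)%N) ->
  `|sws_path steps nu (m + t) (fun h => f h - f (h * g)%g) 1%g| <=
    2%:R * expect m (fun w =>
      (~~ all (fun z => \sum_(s <- w) s - z \in traj 0 w) (box (t + a)))%:R) +
    a%:R * grad_rate nu t.
Proof.
move=> f1 ga gsupp; set phi := fun h => _.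
have phi2 h : `|phi h| <= 2%:R.
  by apply: le_trans (ler_normB _ _) _; rewrite -[2%:R]/(1 + 1); apply: lerD.
rewrite /sws_path expect_cat.
apply: le_trans (ler_norm_expect _ nu_ge0 _ _) _.
rewrite -(expect_cst nu_sum1 m (a%:R * _)) -expectZ -expectD.
apply: le_expect => // u _ _.
have ag0 : 0 <= a%:R * grad_rate nu t by rewrite mulr_ge0 // grad_rate_ge0.
case: (boolP (all _ _)) => [cov|_]; last first.
  rewrite (_ : (~~ false)%:R = 1 :> R) // mulr1.
  apply: (@le_trans _ _ 2%:R); last by rewrite lerDl.
  apply: le_trans (ler_norm_expect _ nu_ge0 _ _) _.
  by apply: expect_le_cst => // v _ _; apply: avgs_norm.
rewrite (_ : (~~ true)%:R = 0 :> R) // mulr0 add0r; set x := \sum_(s <- u) s in cov.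
have covered y : (norm1 y <= t + a)%N -> x + y \in traj 0 u.
  move=> yt; rewrite -[y]opprK; apply: (allP cov); rewrite mem_box.
  by rewrite /= !abszN (leq_trans (leq_addr _ _) yt) (leq_trans (leq_addl _ _) yt).
pose f_u y := avgs (traj 0 u) f (move_by y 1%g).
(* The averages over the sites of v, inside the box, are absorbed by those of u. *)
have last_steps v : size v = t -> {subset v <= steps} ->
    avgs (traj 0 (u ++ v)) phi (move_by (\sum_(s <- u ++ v) s) 1%g) =
    shift_diff g.1 f_u (x + \sum_(s <- v) s).
  move=> sv vst; set y := \sum_(s <- v) s.
  have yt : (norm1 y <= t)%N by rewrite -sv; exact: norm1_sum_steps.
  have -> : \sum_(s <- u ++ v) s = x + y by rewrite big_cat.
  rewrite (eq_avgs (L' := traj 0 u)); last first.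
    move=> z; apply/idP/idP => [/mem_traj_cat/orP[//|]|]; last exact: traj_catl.
    rewrite add0r -/x => /trajP[i iv ->]; apply: covered.
    apply: leq_trans (norm1_sum_steps _) _; first by move=> s /mem_take; exact: vst.
    by rewrite size_takel // (leq_trans iv) // sv leq_addr.
  rewrite avgsB /shift_diff avgs_mul ?move_byD // => z /gsupp za.
  rewrite move_by_pos (_ : (1%g : G).1 = 0) // add0r -addrA.
  by apply: covered; apply: leq_trans (norm1D _ _) _; apply: leq_add.
have -> : expect t (fun v => avgs (traj 0 (u ++ v)) phi (move_by (\sum_(s <- u ++ v) s) 1%g)) =
    walk_op steps nu t (shift_diff g.1 f_u) x.
  apply/eqP; rewrite eq_le; apply/andP.
  by split; apply: le_expect => // v sv vst; rewrite last_steps.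
apply: le_trans (gradient_norm1 law _ _ _ (b := 1) _) _ => [y|].
  by apply: avgs_norm.
by rewrite mul1r ler_wpM2r ?grad_rate_ge0 // ler_nat.
Qed.

End Translation.

Local Open Scope classical_set_scope.
Local Open Scope ring_scope.

(** * Mass functions with finite support *)

Section FiniteMass.
Variables (R : realType) (T : choiceType).
Implicit Types (l : seq (R * T)) (f : T -> R) (V : set T).

(** Measures with finite support are given by lists of weighted points, with repetitions
    allowed: convolution is then a list comprehension, and integrals are finite sums. *)
Definition list_mass l (x : T) : R := \sum_(p <- l) p.1 * (x == p.2)%:R.

Definition list_int l f : R := \sum_(p <- l) p.1 * f p.2.

Definition nonneg_list l : Prop := forall p, p \in l -> 0 <= p.1.

Lemma list_mass_ge0 l x : nonneg_list l -> 0 <= list_mass l x.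
Proof. by move=> l0; rewrite /list_mass big_seq sumr_ge0 // => p /l0 p0; rewrite mulr_ge0. Qed.

Lemma esum_list_mass l V f : nonneg_list l -> (forall x, 0 <= f x) ->
  (\esum_(x in V) (list_mass l x * f x)%:E = (list_int l (fun x => `[< V x >]%:R * f x))%:E)%E.
Proof.
move=> + f0; elim: l => [_|[a y] l IH l0].
  by rewrite /list_int big_nil esum1 // => x _; rewrite /list_mass big_nil mul0r.
have a0 : 0 <= a by have := l0 (a, y); apply; rewrite mem_head.
have l0' : nonneg_list l by move=> p pl; apply: l0; rewrite inE pl orbT.
rewrite /list_int big_cons -/(list_int l _) EFinD -IH //.
under eq_esum => x _ do rewrite /list_mass big_cons -/(list_mass l x) mulrDl EFinD.
rewrite esumD => [|x _|x _]; last first.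
- by rewrite lee_fin mulr_ge0 ?list_mass_ge0.
- by rewrite lee_fin !mulr_ge0.
congr (_ + _)%E.
rewrite /= -(@esum_set1 R T y (fun y => (a * (`[< V y >]%:R * f y))%:E)); last first.
  by rewrite lee_fin !mulr_ge0.
rewrite esum_mkcond [RHS]esum_mkcond; apply: eq_esum => x _.
rewrite in_set1; have [->|xy] := eqVneq x y.
  rewrite mulr1 (_ : (y \in V) = `[< V y >]) //.
  by case: `[< V y >] => /=; rewrite ?mul1r ?mul0r ?mulr0.
by rewrite mulr0 mul0r if_same.
Qed.

Lemma mass_list_mass l V : nonneg_list l ->
  mass (list_mass l) V = list_int l (fun x => `[< V x >]%:R).
Proof.
move=> l0; rewrite /mass.
under eq_esum => x _ do rewrite -[list_mass l x]mulr1.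
by rewrite esum_list_mass //=; apply: eq_bigr => p _; rewrite mulr1.
Qed.

Lemma list_int_list_mass l f (s : seq T) : uniq s -> (forall p, p \in l -> p.2 \in s) ->
  list_int l f = \sum_(x <- s) list_mass l x * f x.
Proof.
move=> us ls; under eq_bigr => x _ do rewrite mulr_suml.
rewrite exchange_big /= /list_int big_seq [RHS]big_seq; apply: eq_bigr => p pl.
rewrite (bigD1_seq p.2) ?ls //= eqxx mulr1 big1 ?addr0 // => x /negPf ->.
by rewrite mulr0 mul0r.
Qed.

Lemma list_intB l f f' : list_int l (fun x => f x - f' x) = list_int l f - list_int l f'.
Proof. by rewrite -sumrB; apply: eq_bigr => p _; rewrite mulrBr. Qed.

End FiniteMass.

Lemma pmf_image_list_mass (R : realType) (T U : choiceType) (f : T -> U) (l : seq (R * T)) :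
  nonneg_list l -> pmf_image f (list_mass l) = list_mass [seq (p.1, f p.2) | p <- l].
Proof.
move=> l0; apply: funext => y; rewrite /pmf_image mass_list_mass // /list_mass big_map.
apply: eq_bigr => p _; congr (_ * _%:R); congr nat_of_bool.
by rewrite eq_sym; apply/asboolP/eqP.
Qed.

Section Convolution.
Variables (R : realType) (G : groupType).
Implicit Types (l : seq (R * G)) (f : G -> R).

Definition list_conv l l' : seq (R * G) :=
  [seq (p.1 * q.1, (p.2 * q.2)%g) | p <- l, q <- l'].

Lemma list_conv_pos l l' : nonneg_list l -> nonneg_list l' -> nonneg_list (list_conv l l').
Proof.
by move=> l0 l0' _ /allpairsP[[p q] [/l0 p0 /l0' q0 ->]] /=; apply: mulr_ge0.
Qed.

Lemma list_int_list_conv l l' f :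
  list_int (list_conv l l') f = list_int l (fun g => list_int l' (fun h => f (g * h)%g)).
Proof.
rewrite /list_int /list_conv big_allpairs_dep /=; apply: eq_bigr => p _.
by rewrite mulr_sumr; apply: eq_bigr => q _; rewrite mulrA.
Qed.

Lemma pmf_conv_list_massl l (q : G -> R) g : nonneg_list l -> (forall x, 0 <= q x) ->
  pmf_conv (list_mass l) q g = list_int l (fun h => q (h^-1 * g)%g).
Proof.
move=> l0 q0; rewrite /pmf_conv esum_list_mass //=; apply: eq_bigr => p _.
by rewrite asboolT // mul1r.
Qed.

Lemma pmf_conv_list_massr (p : G -> R) l g : nonneg_list l -> (forall x, 0 <= p x) ->
  pmf_conv p (list_mass l) g = list_int l (fun h => p (g * h^-1)%g).
Proof.
move=> l0 p0; pose l2 := [seq (q.1, (g * q.2^-1)%g) | q <- l].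
have l20 : nonneg_list l2 by move=> _ /mapP[q ql ->]; exact: (l0 q).
have E h : p h * list_mass l (h^-1 * g)%g = list_mass l2 h * p h.
  rewrite mulrC /list_mass big_map; congr (_ * _); apply: eq_bigr => q _ /=.
  congr (_ * _%:R); congr nat_of_bool.
  by rewrite -[LHS](inj_eq (mulgI h)) mulVKg -[RHS](inj_eq (mulIg q.2)) mulgKV eq_sym.
rewrite /pmf_conv; under eq_esum => h _ do rewrite E.
rewrite esum_list_mass //= /list_int big_map; apply: eq_bigr => q _.
by rewrite asboolT // mul1r.
Qed.

Lemma list_mass_list_conv l l' : nonneg_list l -> nonneg_list l' ->
  pmf_conv (list_mass l) (list_mass l') = list_mass (list_conv l l').
Proof.
move=> l0 l0'; apply: funext => g; rewrite pmf_conv_list_massl //; last first.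
  by move=> x; exact: list_mass_ge0.
rewrite -[RHS]/(list_int (list_conv l l') (fun h => (g == h)%:R)) list_int_list_conv.
apply: eq_bigr => p _; congr (_ * _); apply: eq_bigr => q _.
congr (_ * _%:R); congr nat_of_bool.
by rewrite -[LHS](inj_eq (mulgI p.2)) mulVKg.
Qed.

Fixpoint list_pow l (n : nat) : seq (R * G) :=
  if n is m.+1 then list_conv l (list_pow l m) else [:: (1, 1%g)].

Lemma list_pow_pos l n : nonneg_list l -> nonneg_list (list_pow l n).
Proof.
move=> l0; elim: n => [|n IH]; last exact: list_conv_pos.
by move=> p; rewrite inE => /eqP ->; exact: ler01.
Qed.

Lemma pmf_convn_list_mass l n : nonneg_list l ->
  pmf_convn (list_mass l) n = list_mass (list_pow l n).
Proof.
move=> l0; elim: n => [|n IH] /=.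
  by apply: funext => g; rewrite /list_mass big_seq1 mul1r.
by rewrite IH list_mass_list_conv //; exact: list_pow_pos.
Qed.

(** Tested on the indicators of the sets where the ratio exceeds 1 + eps, respectively
    is below 1 - eps, the assumption bounds the mass of each by delta / eps. *)
Lemma almost_invariant_of_translation l g (eps delta : R) :
  nonneg_list l -> list_int l (fun=> 1) = 1 -> 0 < eps -> 2%:R * delta <= eps ^+ 2 ->
  (forall f : G -> R, (forall h, `|f h| <= 1) ->
     `|list_int l (fun h => f h - f (h * g^-1)%g)| <= delta) ->
  1 - eps <= mass (list_mass l) [set h | 0 < list_mass l h /\
     `|list_mass l (h * g)%g / list_mass l h - 1| <= eps].
Proof.
move=> l0 l1 e0 de inv; set V := [set h | _]; rewrite mass_list_mass //.
pose s := undup ([seq p.2 | p <- l] ++ [seq (p.2 * g^-1)%g | p <- l]).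
have us : uniq s by exact: undup_uniq.
have ls p : p \in l -> p.2 \in s.
  by move=> pl; rewrite mem_undup mem_cat map_f.
have m0 x : 0 <= list_mass l x by exact: list_mass_ge0.
have shifted f : list_int l (fun h => f (h * g^-1)%g) = \sum_(x <- s) list_mass l (x * g)%g * f x.
  transitivity (list_int [seq (p.1, (p.2 * g^-1)%g) | p <- l] f).
    by rewrite /list_int big_map.
  rewrite (list_int_list_mass _ us); last first.
    by move=> _ /mapP[p pl ->]; rewrite mem_undup mem_cat orbC (map_f (fun q => q.2 * g^-1)%g pl).
  apply: eq_bigr => x _; rewrite /list_mass big_map; congr (_ * _).
  apply: eq_bigr => p _; congr (_ * _%:R); congr nat_of_bool.
  by rewrite -(inj_eq (mulIg g)) mulgKV.
have dev (W : pred G) (b : R) : `|b| = 1 ->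
   (forall x, W x -> eps * list_mass l x <= b * (list_mass l x - list_mass l (x * g)%g)) ->
   \sum_(x <- s) list_mass l x * (W x)%:R <= delta / eps.
  move=> b1 Wb; rewrite ler_pdivlMr //.
  have W1 h : `|(W h)%:R : R| <= 1 by rewrite normr_nat lern1 leq_b1.
  apply: le_trans (inv _ W1); rewrite list_intB (shifted (fun h => (W h)%:R)).
  rewrite (list_int_list_mass _ us ls) -sumrB.
  set S := \sum_(x <- s) (_ - _).
  have : b * S <= `|S| by rewrite -[leRHS]mul1r -b1 -normrM ler_norm.
  apply: le_trans; rewrite /S.
  rewrite mulr_suml mulr_sumr; apply: ler_sum => x _.
  rewrite -mulrBl mulrA mulrAC; have [/Wb Wx|_] := boolP (W x); last by rewrite /= !mulr0.
  by rewrite !mulr1 mulrC.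
pose Wp : pred G := fun x => (1 + eps) * list_mass l x < list_mass l (x * g)%g.
pose Wm : pred G := fun x => list_mass l (x * g)%g < (1 - eps) * list_mass l x.
have Hp : \sum_(x <- s) list_mass l x * (Wp x)%:R <= delta / eps.
  apply: (dev _ (-1)) => [|x Wx]; first by rewrite normrN1.
  by move: Wx; rewrite /Wp; lra.
have Hm : \sum_(x <- s) list_mass l x * (Wm x)%:R <= delta / eps.
  apply: (dev _ 1) => [|x Wx]; first by rewrite normr1.
  by move: Wx; rewrite /Wm; lra.
have key : list_int l (fun=> 1) <= list_int l (fun x => `[< V x >]%:R) +
    \sum_(x <- s) list_mass l x * (Wp x)%:R + \sum_(x <- s) list_mass l x * (Wm x)%:R.
  rewrite !(list_int_list_mass _ us ls) -!big_split; apply: ler_sum => x _ /=.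
  rewrite mulr1 -!mulrDr; have [->|mx] := eqVneq (list_mass l x) 0; first by rewrite mul0r.
  have mx0 : 0 < list_mass l x by rewrite lt_neqAle eq_sym mx m0.
  rewrite -[leLHS]mulr1 ler_pM2l // -!natrD ler1n.
  have [//|nV] := boolP `[< V x >]; rewrite add0n lt0n addn_eq0 !eqb0 -negb_or negbK.
  move: nV; apply: contraR; rewrite negb_or -!leNgt => /andP[wp wm].
  apply/asboolP; split=> //; rewrite ler_norml; apply/andP; split.
    by rewrite lerBrDr addrC ler_pdivlMr.
  by rewrite lerBlDr addrC ler_pdivrMr.
have : 2%:R * (delta / eps) <= eps by rewrite mulrA ler_pdivrMr.
move: key Hp Hm; rewrite l1; lra.
Qed.

End Convolution.

(** * The law of the switch-walk-switch walk *)

Section Law.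
Variables (R : realType) (A : zmodType) (F : finGroupType).
Local Notation G := (wreath A F).

Definition switch_list : seq (R * G) :=
  [seq (#|F|%:R^-1, lamp_emb A b) | b <- enum F].

Lemma switch_list_pos : nonneg_list switch_list.
Proof. by move=> _ /mapP[b _ ->]; rewrite invr_ge0. Qed.

Lemma switch_listE : pmf_image (@lamp_emb A F) (@uniform_pmf R F) = list_mass switch_list.
Proof.
have -> : @uniform_pmf R F = list_mass [seq (#|F|%:R^-1, b) | b <- enum F].
  apply: funext => b; rewrite /list_mass big_map big_enum /= (bigD1 b) //= eqxx mulr1.
  by rewrite big1 ?addr0 // => c cb; rewrite eq_sym (negPf cb) mulr0.
rewrite pmf_image_list_mass; last by move=> _ /mapP[b _ ->]; rewrite invr_ge0.
by rewrite -map_comp.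
Qed.

Lemma list_int_switch (f : G -> R) :
  list_int switch_list f = #|F|%:R^-1 * \sum_(b : F) f (lamp_emb A b).
Proof. by rewrite /list_int big_map big_enum mulr_sumr. Qed.

Lemma list_int_switch1 : list_int switch_list (fun=> 1) = 1.
Proof.
rewrite list_int_switch sumr_const mulVf // pnatr_eq0 -lt0n.
by apply/card_gt0P; exists 1%g.
Qed.

Lemma switch_pos c : c \in switch_list -> c.2.1 = 0.
Proof. by move=> /mapP[b _ ->]. Qed.

Lemma pmf_image_base (nu : A -> R) (g : G) : (forall a, 0 <= nu a) ->
  pmf_image (@base_emb A F) nu g = nu g.1 * (g == base_emb F g.1)%:R.
Proof.
move=> nu0; rewrite /pmf_image /mass; case: eqVneq => [ge|gn].
  rewrite (_ : _ @^-1` _ = [set g.1]) ?esum_set1 ?lee_fin ?mulr1 //.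
  by apply/seteqP; split => [a /= <-|a /= ->].
rewrite (_ : _ @^-1` _ = set0) ?esum_set0 ?mulr0 //.
by apply/seteqP; split => // a /= ga; move: gn; rewrite -ga eqxx.
Qed.

Variables (nu : A -> R) (mu : G -> R).
Hypothesis nu_ge0 : forall a, 0 <= nu a.
Hypothesis muE :
  mu = pmf_conv (pmf_conv (pmf_image (@lamp_emb A F) (@uniform_pmf R F))
                          (pmf_image (@base_emb A F) nu))
                (pmf_image (@lamp_emb A F) (@uniform_pmf R F)).

(** On the fibre over a the measure mu coincides with a finitely supported one, whatever
    the support of nu: this gives the support of nu from that of the projection. *)
Lemma pmf_image_base_proj : pmf_image (@base_proj A F) mu = nu.
Proof.
apply: funext => a.
pose m := [:: (nu a, base_emb F a)].
have m0 : nonneg_list m by move=> p; rewrite inE => /eqP -> /=.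
have sw0 := switch_list_pos.
pose la := list_conv (list_conv switch_list m) switch_list.
have la0 : nonneg_list la by apply: list_conv_pos => //; apply: list_conv_pos.
have base0 g : 0 <= pmf_image (@base_emb A F) nu g.
  by rewrite pmf_image_base // mulr_ge0.
have mua (g : G) : g.1 = a -> mu g = list_mass la g.
  move=> ga; rewrite muE switch_listE -list_mass_list_conv //; last exact: list_conv_pos.
  rewrite -list_mass_list_conv //.
  have conv0 (q : G -> R) : (forall k, 0 <= q k) ->
      forall k, 0 <= pmf_conv (list_mass switch_list) q k.
    move=> q0 k; rewrite pmf_conv_list_massl // /list_int big_seq sumr_ge0 // => p /sw0 p0.
    by rewrite mulr_ge0.
  rewrite !pmf_conv_list_massr //;
    try by apply: conv0 => k; do ?[exact: base0 | exact: list_mass_ge0].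
  rewrite /list_int big_seq [RHS]big_seq; apply: eq_bigr => c cs; congr (_ * _).
  rewrite !pmf_conv_list_massl //; last by move=> x; exact: list_mass_ge0.
  rewrite /list_int big_seq [RHS]big_seq; apply: eq_bigr => b bs; congr (_ * _).
  rewrite pmf_image_base // /list_mass big_seq1.
  have -> : (b.2^-1 * (g * c.2^-1))%g.1 = a.
    have inv_pos (x : G) : (x^-1)%g.1 = - x.1 by [].
    by rewrite !mul_pos !inv_pos (switch_pos cs) (switch_pos bs) oppr0 add0r addr0.
  by [].
have -> : pmf_image (@base_proj A F) mu a = mass (list_mass la) (@base_proj A F @^-1` [set a]).
  by rewrite /pmf_image /mass; congr fine; apply: eq_esum => g /= ga; rewrite mua.
rewrite mass_list_mass // !list_int_list_conv.
transitivity (list_int switch_list (fun=> nu a * list_int switch_list (fun=> 1))).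
  rewrite /list_int big_seq [RHS]big_seq; apply: eq_bigr => b bs; congr (_ * _).
  rewrite big_seq1 /=; congr (_ * _); rewrite big_seq [RHS]big_seq; apply: eq_bigr => c cs.
  rewrite asboolT // /base_proj /=.
  by rewrite -[LHS]/(b.2.1 + a + c.2.1) (switch_pos cs) (switch_pos bs) add0r addr0.
rewrite list_int_switch1 mulr1 /list_int -[RHS]mul1r -list_int_switch1 /list_int mulr_suml.
by apply: eq_bigr => b _; rewrite mulr1.
Qed.

Variable st : seq A.
Hypothesis nuE : nu = list_mass [seq (nu s, s) | s <- st].

Definition sws_list : seq (R * G) :=
  list_conv (list_conv switch_list [seq (nu s, base_emb F s) | s <- st]) switch_list.

Lemma sws_list_pos : nonneg_list sws_list.
Proof.
have sw0 := switch_list_pos; apply: list_conv_pos => //; apply: list_conv_pos => //.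
by move=> _ /mapP[s _ ->]; exact: nu_ge0.
Qed.

Lemma sws_listE : mu = list_mass sws_list.
Proof.
have st0 : nonneg_list [seq (nu s, base_emb F s) | s <- st].
  by move=> _ /mapP[s _ ->]; exact: nu_ge0.
have sw0 := switch_list_pos.
rewrite muE switch_listE {1}nuE pmf_image_list_mass; last first.
  by move=> _ /mapP[s _ ->]; exact: nu_ge0.
rewrite -map_comp list_mass_list_conv // list_mass_list_conv //; exact: list_conv_pos.
Qed.

(** The law of the walk, seen through its action on functions. *)
Lemma list_int_list_pow n f h :
  list_int (list_pow sws_list n) (fun g => f (h * g)%g) = iter n (sws st nu (F := F)) f h.
Proof.
have one f' h' : list_int sws_list (fun g => f' (h' * g)%g) = sws st nu f' h'.
  rewrite !list_int_list_conv list_int_switch; congr (_ * _); apply: eq_bigr => b _.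
  by rewrite {1}/list_int big_map; apply: eq_bigr => s _; rewrite list_int_switch.
elim: n h => [|n IH] h; first by rewrite /list_int big_seq1 mul1r mulg1.
rewrite list_int_list_conv iterS -one; apply: eq_bigr => p _; congr (_ * _).
by rewrite -IH; apply: eq_bigr => q _; rewrite mulgA.
Qed.

Lemma list_int_list_pow_path n f : list_int (list_pow sws_list n.+1) f = sws_path st nu n.+1 f 1%g.
Proof.
rewrite -iter_sws -list_int_list_pow; apply: eq_bigr => p _; congr (_ * _).
by rewrite mul1g.
Qed.

End Law.

Section Support.
Variables (R : realType) (nu : Z2 -> R).
Hypothesis nu_pmf : is_pmf nu.
Hypothesis nu_sym : forall a, nu (- a) = nu a.
Hypothesis nu_supp :
  [set a | nu a != 0] = [set (0, 0); (1, 0); (-1, 0); (0, 1); (0, -1)].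

Let nu_suppE a : (nu a != 0) = (a \in steps).
Proof.
have /(congr1 (@^~ a)) /= := nu_supp; rewrite !inE => E.
apply/idP/idP => [|h]; last first.
  rewrite E; move: h; do ![case/predU1P=> [->|]; [by auto 10|]]; move=> /eqP ->; auto 10.
by rewrite E => -[[[[|]|]|]|] ->; rewrite eqxx ?orbT.
Qed.

Lemma nu_list_mass : nu = list_mass [seq (nu s, s) | s <- steps].
Proof.
apply: funext => a; rewrite /list_mass big_map /=.
have [sa|sa] := boolP (a \in steps).
  rewrite (bigD1_seq a) //= eqxx mulr1 big1 ?addr0 // => s /negPf.
  by rewrite eq_sym => ->; rewrite mulr0.
rewrite big_seq big1 => [|s ss]; first by apply/eqP; rewrite -[_ == _]negbK nu_suppE.
by case: eqVneq => [as_|_]; rewrite ?mulr0 //; rewrite as_ ss in sa.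
Qed.

Lemma step_law_of_support : step_law nu.
Proof.
have nu0 := nu_pmf.1; split => //.
  by move=> s ss; rewrite lt_neqAle eq_sym nu_suppE ss nu0.
have l0 : nonneg_list [seq (nu s, s) | s <- steps] by move=> _ /mapP[s _ ->]; exact: nu0.
have E : ((list_int [seq (nu s, s) | s <- steps]
    (fun x => `[< [set: Z2] x >]%:R * 1))%:E = 1%:E)%E.
  by rewrite -esum_list_mass // -nu_list_mass -nu_pmf.2; apply: eq_esum => x _; rewrite mulr1.
rewrite -(EFin_inj E) /list_int big_map; apply: eq_bigr => s _.
by rewrite asboolT // mulr1 mulr1.
Qed.

End Support.

(** * Word length *)

Section WordLength.
Variable F : finGroupType.
Local Notation G := (wreath Z2 F).

(** The walker and the lamps that are on stay within distance c of the origin, and at most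
    c lamps are on.  Being subadditive, the least such c is at most a multiple of the word
    length: the position and the lamps bound the effect of g, their number bounds the
    drift from below. *)
Definition reach (c : nat) (g : G) : Prop :=
  [/\ (norm1 g.1 <= c)%N, forall z, g.2 z != 1%g -> (norm1 z <= c)%N &
      (#|` finsupp g.2| <= c)%N].

Lemma reach_le c d g : (c <= d)%N -> reach c g -> reach d g.
Proof.
move=> cd [g1 g2 g3]; split; [exact: leq_trans cd| |exact: leq_trans cd].
by move=> z /g2 zc; exact: leq_trans cd.
Qed.

Lemma reach1 : reach 0 1%g.
Proof.
have f1 z : (1%g : G).2 z = 1%g by exact: wreath_oneE.
split=> [//|z|]; first by rewrite f1 eqxx.
rewrite leqn0 cardfs_eq0; apply/eqP/fsetP => z.
by rewrite mem_finsupp f1 eqxx inE.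
Qed.

Lemma reach_mul c d g h : reach c g -> reach d h -> reach (c + d) (g * h)%g.
Proof.
move=> [g1 g2 g3] [h1 h2 h3].
have supp z : (g * h)%g.2 z != 1%g -> g.2 z != 1%g \/ h.2 (z - g.1) != 1%g.
  rewrite mul_lamp; case: (eqVneq (g.2 z) 1%g) => [->|]; last by left.
  by rewrite mul1g; right.
split.
- by rewrite mul_pos; apply: leq_trans (norm1D _ _) _; exact: leq_add.
- move=> z /supp[/g2 zc|/h2 zd]; first exact: leq_trans (leq_addr _ _).
  by rewrite -[z](subrK g.1) addnC; apply: leq_trans (norm1D _ _) _; exact: leq_add.
- apply: (@leq_trans #|` (finsupp g.2 `|` [fset (g.1 + y)%R | y in finsupp h.2])%fset|).
    apply: fsubset_leq_card; apply/fsubsetP => z; rewrite mem_finsupp inE => /supp[].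
      by rewrite mem_finsupp => ->.
    move=> hz; apply/orP; right; apply/imfsetP; exists (z - g.1) => /=.
      by rewrite mem_finsupp.
    by rewrite addrC subrK.
  rewrite cardfsU; apply: leq_trans (leq_subr _ _) _; apply: leq_add => //.
  by apply: leq_trans h3; exact: leq_imfset_card.
Qed.

Lemma reach_ex g : exists c, reach c g.
Proof.
exists (norm1 g.1 + \sum_(z <- finsupp g.2) norm1 z + #|` finsupp g.2|)%N; split.
- by rewrite -addnA leq_addr.
- move=> z; rewrite -mem_finsupp => zg; rewrite (big_fsetD1 z) //=.
  apply: leq_trans (leq_addr _ _); apply: leq_trans (leq_addl _ _); exact: leq_addr.
- exact: leq_addl.
Qed.

Variable S : set G.
Hypothesis S_finite : finite_set S.
Hypothesis S_gen : generates S.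

Lemma reach_generators : exists c, forall g, S g \/ S g^-1%g -> reach c g.
Proof.
have /finite_seqP[s Ss] := S_finite.
suff [c cP] : exists c, forall g, g \in s -> reach c g /\ reach c g^-1%g.
  by exists c => g []; rewrite Ss /= => /cP[] //; rewrite invgK.
elim: (s) => [|g l [c IH]]; first by exists 0%N.
have [d dg] := reach_ex g; have [e eg] := reach_ex g^-1%g.
exists (c + d + e)%N => h; rewrite inE => /predU1P[->|/IH[h1 h2]]; split.
- by apply: reach_le dg; lia.
- by apply: reach_le eg; lia.
- by apply: reach_le h1; lia.
- by apply: reach_le h2; lia.
Qed.

Lemma word_lengthP g : product_of_length S (word_length S g) g.
Proof.
have [k0 k0P] := S_gen g.
pose P k := `[< product_of_length S k g >].
have exP : exists k, P k by exists k0; apply/asboolP.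
case: (ex_minnP exP) => k /asboolP kP kmin.
have /xgetPex := ex_intro (fun k => product_of_length S k g /\
  forall j, product_of_length S j g -> (k <= j)%N) k
  (conj kP (fun j jP => kmin j (asboolT jP))).
by move=> /(_ 0%N) [].
Qed.

Lemma reach_word_length : exists c, (0 < c)%N /\ forall g,
  reach (c * word_length S g) g /\ reach (c * word_length S g) g^-1%g.
Proof.
have [c cP] := reach_generators; exists c.+1; split=> // g.
have [s [<- sS ->]] := word_lengthP g.
elim: s sS => [|x s IH] sS.
  by rewrite big_nil muln0 invg1; split; exact: reach1.
have [IH1 IH2] : reach (c.+1 * size s) (\prod_(y <- s) y)%g /\
    reach (c.+1 * size s) (\prod_(y <- s) y)^-1%g.
  by apply: IH => y ys; apply: sS; rewrite inE ys orbT.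
have x1 : reach c.+1 x by apply: reach_le (leqnSn c) (cP _ _); apply: sS; rewrite mem_head.
have x2 : reach c.+1 x^-1%g.
  apply: reach_le (leqnSn c) (cP _ _); rewrite invgK.
  by have /or_comm := sS x (mem_head _ _).
rewrite big_cons /= mulnS invMg; split; first exact: reach_mul.
by rewrite addnC; exact: reach_mul.
Qed.

End WordLength.

(** * The drift and the radius of almost invariance *)

(** By [green_le_hit] a site x is visited with probability at least
    [green n (- x) / green n 0], and the numerators add up to the number of visits. *)
Lemma expected_range_ge (R : realType) (nu : Z2 -> R) (law : step_law nu) n :
  n.+1%:R / green steps nu n 0 <=
    \sum_(x <- box n) expect steps nu n (fun w => (x \in traj 0 w)%:R).
Proof.
have nu0 := law_ge0 law; have nu1 := law_sum1 law.
have G0 : 0 < green steps nu n 0 by apply: lt_le_trans ltr01 (green_ge1 nu0 nu1 n).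
rewrite ler_pdivrMr // mulr_suml.
apply: (@le_trans _ _ (\sum_(x <- box n) green steps nu n (- x))); last first.
  apply: ler_sum => x _; apply: le_trans (green_le_hit nu0 nu1 _ _) _.
  rewrite ler_wpM2r ?(ltW G0) //; apply: le_expect => // w _ _.
  by rewrite -(traj_shift x (- x) 0) subrr add0r.
rewrite exchange_big /= -[leLHS]/(n.+1%:R) -[X in X%:R]card_ord -sumr_const.
apply: ler_sum => j _.
under eq_bigr => x _ do rewrite (kernel0_sym law).
rewrite (sum_kernel0_box law) -{1}(expect_cst nu1 j 1); apply: le_expect => // w wj wst.
suff -> : \sum_(s <- w) s \in box n by [].
have := norm1_sum_steps wst; rewrite wj mem_box /norm1 => h.
have jn : (j <= n)%N by rewrite -ltnS.
by rewrite (leq_trans (leq_addr _ _) (leq_trans h jn)) (leq_trans (leq_addl _ _) (leq_trans h jn)).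
Qed.

Section Drift.
Variables (R : realType) (F : finGroupType) (nu : Z2 -> R).
Hypothesis law : step_law nu.
Variable S : set (wreath Z2 F).
Hypothesis F2 : (2 <= #|F|)%N.

Let nu0 := law_ge0 law.
Local Notation mu := (list_mass (sws_list F nu steps)).

(** A visited site carries a lit lamp with probability at least 1 / 2, and the word length
    is at least the number of lit lamps divided by c. *)
Lemma drift_ge c n : (0 < c)%N -> (0 < n)%N ->
  (forall g, reach (c * word_length S g) g) ->
  n.+1%:R / (2%:R * c%:R * green steps nu n 0) <= drift S mu n.
Proof.
move=> c0 n0 cP; have l0 := @sws_list_pos R _ F nu nu0 steps.
have c0' : 0 < c%:R :> R by rewrite ltr0n.
have -> : drift S mu n =
    list_int (list_pow (sws_list F nu steps) n) (fun g => (word_length S g)%:R).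
  rewrite /drift pmf_convn_list_mass //; under eq_esum => g _ do rewrite mulrC.
  rewrite esum_list_mass //; last exact: list_pow_pos.
  by apply: eq_bigr => p _; rewrite asboolT // mul1r.
apply: (@le_trans _ _ (c%:R^-1 * (2%:R^-1 * (n.+1%:R / green steps nu n 0)))).
  by rewrite !invfM le_eqVlt; apply/orP; left; apply/eqP; ring.
apply: (@le_trans _ _ (list_int (list_pow (sws_list F nu steps) n) (fun g =>
    c%:R^-1 * \sum_(x <- box n) (g.2 x != 1%g)%:R))); last first.
  rewrite /list_int big_seq [leRHS]big_seq; apply: ler_sum => p pl.
  rewrite ler_wpM2l ?(list_pow_pos l0 pl) //.
  rewrite mulrC ler_pdivrMr // -natr_sum -natrM ler_nat mulnC.
  have [_ _ ] := cP p.2; apply: leq_trans.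
  have -> : (\sum_(x <- box n) (p.2.2 x != 1%g) = size [seq x <- box n | p.2.2 x != 1%g])%N.
    by rewrite size_filter -sum1_count [RHS]big_mkcond; apply: eq_bigr => x _; case: ifP.
  apply: uniq_leq_size; first by rewrite filter_uniq // box_uniq.
  by move=> x; rewrite mem_filter => /andP[px _]; rewrite -/(x \in finsupp p.2.2) mem_finsupp.
have -> : list_int (list_pow (sws_list F nu steps) n) (fun g : wreath Z2 F =>
    c%:R^-1 * \sum_(x <- box n) (g.2 x != 1%g)%:R) =
  c%:R^-1 * \sum_(x <- box n)
    list_int (list_pow (sws_list F nu steps) n) (fun g => (g.2 x != 1%g)%:R).
  rewrite /list_int exchange_big mulr_sumr; apply: eq_bigr => p _.
  by rewrite mulrCA mulr_sumr.
rewrite ler_wpM2l ?invr_ge0 ?ler0n //.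
apply: le_trans (ler_wpM2l _ (expected_range_ge law n)) _; first by rewrite invr_ge0.
rewrite mulr_sumr; apply: ler_sum => x _.
case: n n0 => [//|n] _; rewrite list_int_list_pow_path -expectZ; apply: le_expect => // w _ _.
have [xw|_] := boolP (x \in traj 0 w); first by rewrite mulr1; exact: avgs_lamp.
by rewrite mulr0; apply: avgs_ge.
Qed.

End Drift.

(** All the scales are powers of 2, of 2 ^ (loglog n), or of 2 ^ (2 ^ (loglog n)): the
    last two are comparable to log n and, on a logarithmic scale, to n. *)
Definition loglog (n : nat) : nat := trunc_log 2 (trunc_log 2 n).

Lemma loglog_ge l n : (2 ^ (2 ^ l) <= n)%N -> (l <= loglog n)%N.
Proof. by move=> ln; do 2! apply: trunc_log_max => //. Qed.

Lemma loglog_bounds n : (2 <= n)%N ->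
  (2 ^ (2 ^ loglog n) <= n < 2 ^ (2 ^ (loglog n).+1))%N.
Proof.
move=> n2; have n0 : (0 < n)%N by lia.
have l0 : (0 < trunc_log 2 n)%N by apply: trunc_log_max.
apply/andP; split.
  by apply: (leq_trans _ (trunc_logP (isT : 1 < 2)%N n0)); rewrite leq_exp2l // trunc_logP.
by apply: leq_trans (trunc_log_ltn n (isT : 1 < 2)%N) _; rewrite leq_exp2l // trunc_log_ltn.
Qed.

Section Radius.
Variables (R : realType) (F : finGroupType) (nu : Z2 -> R).
Hypothesis law : step_law nu.
Hypothesis F2 : (2 <= #|F|)%N.

Let nu0 := law_ge0 law.
Let k0 := kappa_ge0 law.
Local Notation steps_law := (sws_list F nu steps).
Local Notation mu := (list_mass steps_law).

Let mu_pos : nonneg_list steps_law := @sws_list_pos R _ F nu nu0 steps.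

(** The square root of the length 16 ^ (loglog n) of the final stretch, of order
    (log n) ^ 2. *)
Definition rate (n : nat) : R := (4 ^ loglog n)%:R.

Lemma list_int_list_pow1 n : (0 < n)%N -> list_int (list_pow steps_law n) (fun=> 1) = 1.
Proof.
case: n => [//|n] _; rewrite list_int_list_pow_path /sws_path.
rewrite -[RHS](expect_cst (law_sum1 law) n.+1).
apply: eq_expect => w _; apply/eqP; rewrite eq_le avgs_ge // andbT.
by apply: le_trans (ler_norm _) _; apply: avgs_norm => h; rewrite normr1.
Qed.

Lemma grad_rate_scale l : grad_rate nu (16 ^ l) <= Num.sqrt (kappa nu) / (4 ^ l)%:R.
Proof.
have p0 : 0 < (4 ^ l)%:R :> R by rewrite ltr0n expn_gt0.
have -> : Num.sqrt (kappa nu) / (4 ^ l)%:R = Num.sqrt (kappa nu / (4 ^ l)%:R ^+ 2).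
  by rewrite sqrtrM // -exprVn sqrtr_sqr ger0_norm // invr_ge0 ltW.
apply: ler_wsqrtr; rewrite ler_wpM2l // lef_pV2 ?posrE ?exprn_gt0 ?ltr0n ?expn_gt0 //.
by rewrite -natrX ler_nat -expnM mulnC expnM.
Qed.

(** [sws_path_translate] for the last 16 ^ l steps, with [covering] for the others. *)
Lemma translation_le K l n a (g : wreath Z2 F) (f : wreath Z2 F -> R) :
  (2 <= K)%N -> 3200%:R * lag_cst nu <= K%:R -> (108 * K + 2 <= l)%N ->
  (2 ^ (2 ^ l) <= n)%N -> (a <= 16 ^ l)%N -> reach a g -> (forall h, `|f h| <= 1) ->
  `|list_int (list_pow steps_law n) (fun h => f h - f (h * g)%g)| <=
    2%:R * (cover_cst nu K / l.+1%:R) + a%:R * grad_rate nu (16 ^ l).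
Proof.
move=> K2 KC Kl ln aT [g1 g2 _] f1.
have Tn : (16 ^ l <= n)%N.
  by apply: leq_trans ln; apply: leq_trans (attempts_fit K2 Kl); rewrite leq_addl.
pose m := (n - 16 ^ l)%N; have nE : n = (m + 16 ^ l)%N by rewrite /m subnK.
have n0 : (0 < n)%N by apply: leq_trans Tn; rewrite expn_gt0.
rewrite -(prednK n0) list_int_list_pow_path (prednK n0) {1}nE.
apply: le_trans (sws_path_translate law m (16 ^ l) f1 g1 g2) _.
have lm : (2 ^ (2 ^ l) <= m + 16 ^ l)%N by rewrite -nE.
rewrite lerD2r ler_wpM2l //; apply: le_trans (covering law K2 KC Kl lm).
apply: le_expect => // w _ _; rewrite ler_nat.
have [cov|_] := boolP (all _ (box (2 * 16 ^ l))); last by rewrite leq_b1.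
rewrite leqn0 eqb0 negbK; apply/allP => z; rewrite mem_box => /andP[z1 z2].
have r : (16 ^ l + a <= 2 * 16 ^ l)%N by rewrite mul2n -addnn leq_add2l.
by apply: (allP cov); rewrite mem_box (leq_trans z1 r) (leq_trans z2 r).
Qed.

Variable S : set (wreath Z2 F).
Hypothesis finS : finite_set S.
Hypothesis genS : generates S.

(** By [drift_ge] and [green_le], n / L(n) is O(2 ^ (loglog n)). *)
Lemma rate_drift : (fun n : nat => rate n / (n%:R / drift S mu n)) @ \oo --> +oo.
Proof.
have [c [c0 cP]] := reach_word_length finS genS.
have c0' : 0 < c%:R :> R by rewrite ltr0n.
apply/cvgryPge => B.
pose l0 := Num.bound (16%:R * c%:R * kappa nu * `|B|).
exists (2 ^ (2 ^ l0))%N => // n /= ln.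
have l0n := loglog_ge ln.
have n2 : (2 <= n)%N.
  by apply: leq_trans ln; rewrite -{1}(expn1 2) leq_exp2l // expn_gt0.
have n0 : 0 < n%:R :> R by rewrite ltr0n; lia.
set G := green steps nu n 0.
have G0 : 0 < G by apply: lt_le_trans ltr01 (green_ge1 nu0 (law_sum1 law) n).
have drift_n : n.+1%:R / (2%:R * c%:R * G) <= drift S mu n.
  by apply: drift_ge => //; [lia|move=> g; have [] := cP g].
have G_le : G <= 8%:R * kappa nu * (2 ^ loglog n)%:R.
  have /andP[_ nlt] := loglog_bounds n2.
  apply: le_trans (green_le law nlt) _.
  rewrite -subr_ge0.
  have -> : 8%:R * kappa nu * (2 ^ loglog n)%:R - 2%:R * kappa nu * (2 ^ (loglog n).+1).+1%:R =
    2%:R * kappa nu * (4%:R * (2 ^ loglog n)%:R - (2 ^ (loglog n).+1).+1%:R) by ring.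
  rewrite !mulr_ge0 // subr_ge0 -natrM ler_nat expnS.
  have : (0 < 2 ^ loglog n)%N by rewrite expn_gt0.
  lia.
rewrite /rate invf_div mulrA ler_pdivlMr //.
have B_le : 16%:R * c%:R * kappa nu * `|B| <= (2 ^ loglog n)%:R.
  apply: le_trans (ltW (archi_boundP _)) _; first by rewrite !mulr_ge0.
  rewrite ler_nat; apply: leq_trans l0n _; exact/ltnW/ltn_expl.
apply: le_trans (ler_wpM2l (ler0n _ _) drift_n).
rewrite mulrA ler_pdivlMr; last by rewrite !mulr_gt0.
apply: (@le_trans _ _ (`|B| * n%:R * (2%:R * c%:R * (8%:R * kappa nu * (2 ^ loglog n)%:R)))).
  apply: (@le_trans _ _ (`|B| * n%:R * (2%:R * c%:R * G))).
    by rewrite !ler_wpM2r ?ler_norm // !mulr_ge0 // ltW.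
  by rewrite ler_wpM2l ?ler_wpM2l ?mulr_ge0.
have -> : (4 ^ loglog n)%:R = (2 ^ loglog n)%:R * (2 ^ loglog n)%:R :> R.
  by rewrite -natrM -expnMn.
set X : R := (2 ^ loglog n)%:R in B_le *; have X0 : 0 <= X by [].
have -> : `|B| * n%:R * (2%:R * c%:R * (8%:R * kappa nu * X)) =
  16%:R * c%:R * kappa nu * `|B| * (X * n%:R) by ring.
apply: le_trans (ler_wpM2r _ B_le) _; first by rewrite mulr_ge0.
by rewrite mulrA ler_wpM2l ?mulr_ge0 // ler_nat.
Qed.

(** Both terms of [translation_le] vanish in the limit: the first is O(1 / l), and the
    second is at most a constant times a / 4 ^ l, where 4 ^ l is the rate. *)
Lemma rate_invariance_radius : invariance_radius_succeq S mu rate.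
Proof.
have [c [c0 cP]] := reach_word_length finS genS.
have c0' : 0 < c%:R :> R by rewrite ltr0n.
move=> r2 r2_ge0 r2_rate eps g eps0 gr.
exists (fun n => [set h | 0 < pmf_convn mu n h /\
   `|pmf_convn mu n (h * g n)%g / pmf_convn mu n h - 1| <= eps]).
have [K K2 KC] : exists2 K : nat, (2 <= K)%N & 3200%:R * lag_cst nu <= K%:R.
  (* K must make a round visit a given site at least half of the time, see [covering]. *)
  exists (Num.bound (3200%:R * lag_cst nu)).+2 => //.
  apply: le_trans (ltW (archi_boundP _)) _.
    by apply: mulr_ge0; [exact: ler0n | exact: lag_cst_ge0].
  rewrite ler_nat; exact: leq_trans (leqnSn _) (leqnSn _).
pose B := cover_cst nu K; have B0 : 0 <= B by exact: cover_cst_ge0.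
pose e1 := eps ^+ 2 / 8%:R; have e10 : 0 < e1 by rewrite divr_gt0 // exprn_gt0.
pose l1 := Num.bound (B / e1).
have s0 : 0 <= Num.sqrt (kappa nu) by exact: sqrtr_ge0.
(* The first bound controls the translation of the end point, the second one keeps g
   inside the covered box. *)
pose e2 := Num.min (e1 / (c%:R * (1 + Num.sqrt (kappa nu)))) c%:R^-1.
have e20 : 0 < e2.
  by rewrite lt_min invr_gt0 c0' divr_gt0 // mulr_gt0 // ltr_wpDr.
have sum_le (x y : R) : x <= e1 -> y <= e1 -> 2%:R * (2%:R * x + y) <= 8%:R * e1.
  move=> xe ye; rewrite [leRHS](_ : _ = 2%:R * (2%:R * e1 + 2%:R * e1)); last by ring.
  rewrite ler_wpM2l // lerD ?ler_wpM2l // (le_trans ye) // ler_peMl ?ler1n //.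
  exact: ltW.
have [N1 _ small] := cvgr0_norm_lt _ r2_rate _ e20.
exists (maxn N1 (2 ^ (2 ^ (108 * K + 2 + l1)))) => // n /=; rewrite geq_max => /andP[N1n ln].
split; last by [].
have lK := loglog_ge ln; set l := loglog n in lK.
have n2 : (2 <= n)%N.
  by apply: leq_trans ln; rewrite -{1}(expn1 2) leq_exp2l // expn_gt0.
have /andP[ln2 _] := loglog_bounds n2; rewrite -/l in ln2.
have lK' : (108 * K + 2 <= l)%N by apply: leq_trans lK; rewrite leq_addr.
pose a := (c * word_length S (g n))%N.
have rate0 : 0 < rate n by rewrite ltr0n expn_gt0.
have a_le : a%:R <= c%:R * r2 n by rewrite natrM ler_wpM2l.
have /= := small n N1n; rewrite ger0_norm ?divr_ge0 // lt_min => /andP[small1 small2].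
have l_gt0 : (0 < l)%N by apply: leq_trans lK'; rewrite addn2.
have aT : (a <= 16 ^ l)%N.
  rewrite -(ler_nat R); apply: le_trans a_le _.
  apply: (@le_trans _ _ (rate n)); last by rewrite ler_nat leq_exp2r.
  by rewrite -ler_pdivlMl // -ler_pdivrMr // ltW.
have a_gam : a%:R * grad_rate nu (16 ^ l) <= e1.
  have rate_l := grad_rate_scale l.
  apply: (@le_trans _ _ (c%:R * r2 n * (Num.sqrt (kappa nu) / rate n))).
    by rewrite ler_pM // grad_rate_ge0.
  have -> : c%:R * r2 n * (Num.sqrt (kappa nu) / rate n) =
    (c%:R * Num.sqrt (kappa nu)) * (r2 n / rate n) by ring.
  apply: le_trans (ler_wpM2l _ (ltW small1)) _; first by rewrite mulr_ge0.
  rewrite mulrCA -[leRHS]mulr1 ler_wpM2l ?(ltW e10) //.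
  rewrite ler_pdivrMr ?mul1r ?ler_wpM2l ?lerDr //.
  by rewrite mulr_gt0 // ltr_wpDr.
have B_e1 : B / l.+1%:R <= e1.
  rewrite ler_pdivrMr // mulrC -ler_pdivrMr //.
  apply: le_trans (ltW (archi_boundP _)) _; first by rewrite divr_ge0 // ltW.
  rewrite ler_nat -/l1; apply: leq_trans (leqnSn _); apply: leq_trans lK.
  exact: leq_addl.
rewrite pmf_convn_list_mass //.
apply: (almost_invariant_of_translation
  (delta := 2%:R * (B / l.+1%:R) + a%:R * grad_rate nu (16 ^ l))) => //.
- exact: list_pow_pos.
- by apply: list_int_list_pow1; rewrite (leq_trans _ n2).
- have -> : eps ^+ 2 = 8%:R * e1 by rewrite /e1; field.
  exact: sum_le.
move=> f f1; apply: translation_le => //.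
by have [] := cP (g n).
Qed.

End Radius.

Theorem corollary4p8 (R : realType) (F : finGroupType)
    (mu : wreath (int * int)%type F -> R)
    (S : set (wreath (int * int)%type F)) :
  (2 <= #|F|)%N ->
  switch_walk_switch mu ->
  aperiodic mu ->
  [set a : int * int |
     pmf_image (@base_proj (int * int)%type F) mu a != 0] =
    [set (0, 0); (1, 0); (-1, 0); (0, 1); (0, -1)] ->
  finite_set S ->
  generates S ->
  exists rho : nat -> R,
    [/\ forall n, 0 <= rho n,
        (fun n : nat => rho n / (n%:R / drift S mu n)) @ \oo --> +oo &
        invariance_radius_succeq S mu rho].
Proof.
move=> F2 [nu [nu_pmf nu_sym muE]] _ supp finS genS.
have nu0 := nu_pmf.1.
rewrite (pmf_image_base_proj nu0 muE) in supp.
have law := step_law_of_support nu_pmf nu_sym supp.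
have nuE := nu_list_mass supp.
rewrite (sws_listE nu0 muE nuE) {muE mu}.
exists (@rate R); split=> [n||].
- exact: ler0n.
- exact: rate_drift.
- exact: rate_invariance_radius.
Qed.
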